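(* Every oriented matroid of rank $r\le 3$ is HK.
   Context: Oriented matroids are given as $M=(E,\mathcal L)$ with $E$ a finite ground set and $\mathcal L\subseteq\{+,0,-\}^E$ the set of covectors (including $\mathbf 0$); $r(M)$ is the rank. Oriented matroid program. This is a triple $\pi=(M,g,f)$ with $M=(E,\mathcal L)$ an oriented matroid, $g\in E$ not a loop, $f\in E$, $f\ne g$, not a coloop. Its feasible region is $P_\pi=\{X\in\mathcal L: X_g=+,\ X_e\in\{+,0\}\text{ for all }e\in E\setminus\{g,f\}\}$. $P_\pi$ is unbounded if it is nonempty and there is a nonzero $X\in\mathcal L$ with $X_g=0$ and $X_e\in\{+,0\}$ for all $e\in E\setminus\{g,f\}$; otherwise it is bounded. $P_\pi$ is full dimensional if it contains a tope of $M$. The graph $G_\pi$. Its vertices are the cocircuits $V$ of $M\setminus f$ (deletion) with $V_g=+$. Two distinct vertices $V^1,V^2$ are joined by an edge if they are the two cocircuits below a common rank-2 covector of $M\setminus f$ (an element of height 2 in the big face lattice), namely $V^1\circ V^2=V^2\circ V^1$. For such an edge, let $Z$ be the unique cocircuit of $M\setminus f$ obtained by eliminating $g$ from $-V^1$ and $V^2$: $Z_g=0$, $Z^+\subseteq (V^1)^-\cup (V^2)^+$, $Z^-\subseteq (V^1)^+\cup (V^2)^-$. Let $\sigma(Z)\in\{+,0,-\}$ be the unique sign such that extending $Z$ by $Z_f=\sigma(Z)$ gives a cocircuit of $M$. The edge is oriented from $V^1$ to $V^2$ if $\sigma(Z)=+$, from $V^2$ to $V^1$ if $\sigma(Z)=-$,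 and is non-oriented if $\sigma(Z)=0$ (so edges are oriented from the negative side of $f$ toward the positive side). $G_\pi^+$ is the subgraph of $G_\pi$ induced on the vertices $V$ with $V_e\in\{+,0\}$ for all $e\in E\setminus\{g,f\}$. The objective $f$ is generic in $P_\pi$ if $G_\pi^+$ has no non-oriented edge. $\pi$ is proper if $P_\pi$ is bounded and full dimensional and $f$ is generic in $P_\pi$. (For proper $\pi$, $G_\pi^+$ has a unique source and a unique sink.) Holt-Klee condition in dimension $d$: a digraph with a unique source and a unique sink satisfies it if there are $d$ directed paths from the source to the sink that are pairwise internally vertex-disjoint. A proper program $\pi=(M,g,f)$ is HK if $G_\pi^+$ satisfies the Holt-Klee condition in dimension $d=r(M)-1$. An oriented matroid $M$ is HK if for every oriented matroid $N=(E_N,\mathcal L_N)$ obtained from $M$ by reorientation and taking minors (including $M$ itself) and any two distinct $f,g\in E_N$ for which $(N,g,f)$ is a proper oriented matroid program, $(N,g,f)$ is HK (with $d=r(N)-1$). *)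

(* Defs.v *)
From HB Require Import structures.
From mathcomp Require Import all_boot.

Set Implicit Arguments.
Unset Strict Implicit.
Unset Printing Implicit Defensive.

Inductive sign := Neg | Zero | Pos.

Definition sign_code (s : sign) : option bool :=
  match s with Neg => Some false | Zero => None | Pos => Some true end.

Definition sign_decode (o : option bool) : sign :=
  match o with Some false => Neg | None => Zero | Some true => Pos end.

Lemma sign_codeK : cancel sign_code sign_decode.
Proof. by case. Qed.

HB.instance Definition _ := Finite.copy sign (can_type sign_codeK).

Definition opps (s : sign) : sign :=
  match s with Neg => Pos | Zero => Zero | Pos => Neg end.

(* Every ground set is a subset E of an ambient finite type T; a sign vector  *)
(* on E is represented by the function on T extending it by Zero off E, so    *)
(* that all minors of an oriented matroid have sign vectors of the same type. *)
Notation signvec T := {ffun T -> sign}.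

Section SignVectors.
Variable T : finType.
Implicit Types (X Y : signvec T) (A : {set T}) (L : {set signvec T}).

Definition zerov : signvec T := [ffun=> Zero].

Definition oppv X : signvec T := [ffun e => opps (X e)].

Definition compv X Y : signvec T :=
  [ffun e => if X e == Zero then Y e else X e].

Definition separates X Y (e : T) : bool := (X e != Zero) && (X e == opps (Y e)).

Definition supp X : {set T} := [set e | X e != Zero].

(* The order of the big face lattice. *)
Definition confle X Y : bool :=
  [forall e, (X e == Zero) || (X e == Y e)].

Definition restrictv A X : signvec T :=
  [ffun e => if e \in A then X e else Zero].

Definition flipv A X : signvec T :=
  [ffun e => if e \in A then opps (X e) else X e].

Definition setv X (f : T) (s : sign) : signvec T :=
  [ffun e => if e == f then s else X e].

(* The largest number of elements of a chain of nonzero members of L below X, *)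
(* i.e. the length of a longest chain from 0 to X when X is in L.             *)
Definition is_chain (C : {set signvec T}) : bool :=
  [forall Y in C, forall Z in C, confle Y Z || confle Z Y].

Definition height L X : nat :=
  \max_(C : {set signvec T} |
          is_chain C && (C \subset [set Y in L | (Y != zerov) && confle Y X]))
    #|C|.

End SignVectors.

Arguments zerov {T}.

Record orientedMatroid (T : finType) := OrientedMatroid {
  ground : {set T};
  covectors : {set signvec T};
  covector_off : forall X, X \in covectors ->
    forall e, e \notin ground -> X e = Zero;
  covector0 : zerov \in covectors;
  covectorN : forall X, X \in covectors -> oppv X \in covectors;
  covectorC : forall X Y, X \in covectors -> Y \in covectors ->
    compv X Y \in covectors;
  covectorE : forall X Y, X \in covectors -> Y \in covectors ->
    forall e, separates X Y e ->
    exists Z, [/\ Z \in covectors, Z e = Zero &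
      forall e', ~~ separates X Y e' -> Z e' = compv X Y e']
}.

Section Operations.
Variables (T : finType) (M : orientedMatroid T) (A : {set T}).

Lemma restrictv_in (B : {set T}) (X : signvec T) e :
  e \in B -> restrictv B X e = X e.
Proof. by rewrite ffunE => ->. Qed.

Lemma restrictv_out (B : {set T}) (X : signvec T) e :
  e \notin B -> restrictv B X e = Zero.
Proof. by rewrite ffunE => /negbTE->. Qed.

Lemma restrictv0 (B : {set T}) : restrictv B zerov = zerov :> signvec T.
Proof. by apply/ffunP => e; rewrite !ffunE; case: ifP. Qed.

Lemma restrictvN (B : {set T}) (X : signvec T) :
  restrictv B (oppv X) = oppv (restrictv B X).
Proof. by apply/ffunP => e; rewrite !ffunE; case: ifP. Qed.

Lemma restrictvC (B : {set T}) (X Y : signvec T) :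
  restrictv B (compv X Y) = compv (restrictv B X) (restrictv B Y).
Proof. by apply/ffunP => e; rewrite !ffunE; case: ifP. Qed.

Lemma separates_restrictv (B : {set T}) (X Y : signvec T) e :
  separates (restrictv B X) (restrictv B Y) e = (e \in B) && separates X Y e.
Proof. by rewrite /separates !ffunE; case: ifP. Qed.

Lemma flipv0 (B : {set T}) : flipv B zerov = zerov :> signvec T.
Proof. by apply/ffunP => e; rewrite !ffunE; case: ifP. Qed.

Lemma flipvN (B : {set T}) (X : signvec T) :
  flipv B (oppv X) = oppv (flipv B X).
Proof. by apply/ffunP => e; rewrite !ffunE; case: ifP. Qed.

Lemma flipvC (B : {set T}) (X Y : signvec T) :
  flipv B (compv X Y) = compv (flipv B X) (flipv B Y).
Proof.
by apply/ffunP => e; rewrite !ffunE; case: ifP => // _; case: (X e).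
Qed.

Lemma separates_flipv (B : {set T}) (X Y : signvec T) :
  separates (flipv B X) (flipv B Y) =1 separates X Y.
Proof.
by move=> e; rewrite /separates !ffunE; case: ifP => // _; case: (X e) (Y e) => -[].
Qed.

Definition del_covectors : {set signvec T} :=
  [set restrictv (ground M :\: A) X | X in covectors M].

Definition contr_covectors : {set signvec T} :=
  [set restrictv (ground M :\: A) X
     | X in covectors M & [forall e in A, X e == Zero]].

Definition reor_covectors : {set signvec T} :=
  [set flipv A X | X in covectors M].

Fact del_off X : X \in del_covectors ->
  forall e, e \notin ground M :\: A -> X e = Zero.
Proof. by case/imsetP=> X' _ -> e; apply: restrictv_out. Qed.

Fact del0 : zerov \in del_covectors.
Proof. by apply/imsetP; exists zerov; rewrite ?restrictv0 ?covector0. Qed.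

Fact delN X : X \in del_covectors -> oppv X \in del_covectors.
Proof.
by case/imsetP=> X' LX ->; rewrite -restrictvN imset_f ?covectorN.
Qed.

Fact delC X Y : X \in del_covectors -> Y \in del_covectors ->
  compv X Y \in del_covectors.
Proof.
case/imsetP=> X' LX -> /imsetP[Y' LY ->].
by rewrite -restrictvC imset_f ?covectorC.
Qed.

Fact delE X Y : X \in del_covectors -> Y \in del_covectors ->
  forall e, separates X Y e ->
  exists Z, [/\ Z \in del_covectors, Z e = Zero &
    forall e', ~~ separates X Y e' -> Z e' = compv X Y e'].
Proof.
case/imsetP=> X' LX -> /imsetP[Y' LY ->] e.
rewrite separates_restrictv => /andP[Be /(covectorE LX LY)[Z [LZ Ze ZE]]].
exists (restrictv (ground M :\: A) Z); split; first exact: imset_f.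
  by rewrite restrictv_in.
move=> e'; rewrite separates_restrictv -restrictvC.
have [Be' /= /ZE|nBe' _] := boolP (e' \in ground M :\: A).
  by rewrite !restrictv_in.
by rewrite !restrictv_out.
Qed.

Definition deletion : orientedMatroid T :=
  OrientedMatroid del_off del0 delN delC delE.

Fact contr_off X : X \in contr_covectors ->
  forall e, e \notin ground M :\: A -> X e = Zero.
Proof. by case/imsetP=> X' _ -> e; apply: restrictv_out. Qed.

Fact contr0 : zerov \in contr_covectors.
Proof.
apply/imsetP; exists zerov; rewrite ?restrictv0 // inE covector0.
by apply/forall_inP=> e _; rewrite ffunE.
Qed.

Fact contrN X : X \in contr_covectors -> oppv X \in contr_covectors.
Proof.
case/imsetP=> X' /setIdP[LX /forall_inP X0] ->; rewrite -restrictvN imset_f //.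
rewrite inE covectorN //=; apply/forall_inP=> e Ae.
by rewrite ffunE (eqP (X0 e Ae)).
Qed.

Fact contrC X Y : X \in contr_covectors -> Y \in contr_covectors ->
  compv X Y \in contr_covectors.
Proof.
case/imsetP=> X' /setIdP[LX /forall_inP X0] ->.
case/imsetP=> Y' /setIdP[LY /forall_inP Y0] ->.
rewrite -restrictvC imset_f // inE covectorC //=; apply/forall_inP=> e Ae.
by rewrite ffunE X0 ?Y0.
Qed.

Fact contrE X Y : X \in contr_covectors -> Y \in contr_covectors ->
  forall e, separates X Y e ->
  exists Z, [/\ Z \in contr_covectors, Z e = Zero &
    forall e', ~~ separates X Y e' -> Z e' = compv X Y e'].
Proof.
case/imsetP=> X' /setIdP[LX /forall_inP X0] ->.
case/imsetP=> Y' /setIdP[LY /forall_inP Y0] -> e.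
rewrite separates_restrictv => /andP[Be /(covectorE LX LY)[Z [LZ Ze ZE]]].
exists (restrictv (ground M :\: A) Z); split.
- rewrite imset_f // inE LZ; apply/forall_inP=> a Aa.
  by rewrite ZE ?ffunE /separates ?X0 ?Y0.
- by rewrite restrictv_in.
move=> e'; rewrite separates_restrictv -restrictvC.
have [Be' /= /ZE|nBe' _] := boolP (e' \in ground M :\: A).
  by rewrite !restrictv_in.
by rewrite !restrictv_out.
Qed.

Definition contraction : orientedMatroid T :=
  OrientedMatroid contr_off contr0 contrN contrC contrE.

Fact reor_off X : X \in reor_covectors ->
  forall e, e \notin ground M -> X e = Zero.
Proof.
case/imsetP=> X' LX -> e Ee.
by rewrite ffunE (covector_off LX Ee); case: ifP.
Qed.

Fact reor0 : zerov \in reor_covectors.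
Proof. by apply/imsetP; exists zerov; rewrite ?flipv0 ?covector0. Qed.

Fact reorN X : X \in reor_covectors -> oppv X \in reor_covectors.
Proof. by case/imsetP=> X' LX ->; rewrite -flipvN imset_f ?covectorN. Qed.

Fact reorC X Y : X \in reor_covectors -> Y \in reor_covectors ->
  compv X Y \in reor_covectors.
Proof.
case/imsetP=> X' LX -> /imsetP[Y' LY ->].
by rewrite -flipvC imset_f ?covectorC.
Qed.

Fact reorE X Y : X \in reor_covectors -> Y \in reor_covectors ->
  forall e, separates X Y e ->
  exists Z, [/\ Z \in reor_covectors, Z e = Zero &
    forall e', ~~ separates X Y e' -> Z e' = compv X Y e'].
Proof.
case/imsetP=> X' LX -> /imsetP[Y' LY ->] e.
rewrite separates_flipv => /(covectorE LX LY)[Z [LZ Ze ZE]].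
exists (flipv A Z); split; first exact: imset_f.
  by rewrite ffunE Ze; case: ifP.
move=> e'; rewrite separates_flipv -flipvC => /ZE Ze'.
by rewrite [LHS]ffunE [RHS]ffunE Ze'.
Qed.

Definition reorientation : orientedMatroid T :=
  OrientedMatroid reor_off reor0 reorN reorC reorE.

End Operations.

Inductive reoriented_minor (T : finType) (M : orientedMatroid T) :
    orientedMatroid T -> Prop :=
| RMinor_refl : reoriented_minor M M
| RMinor_reor N A : reoriented_minor M N ->
    reoriented_minor M (reorientation N A)
| RMinor_del N A : reoriented_minor M N -> reoriented_minor M (deletion N A)
| RMinor_contr N A : reoriented_minor M N ->
    reoriented_minor M (contraction N A).

Section Covectors.
Variables (T : finType) (M : orientedMatroid T).

(* The common height of the topes in the big face lattice, which is the rank  *)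
(* of the underlying matroid.                                                 *)
Definition rank : nat := \max_(X in covectors M) height (covectors M) X.

Definition cocircuits : {set signvec T} :=
  [set X in covectors M | (X != zerov) &&
     [forall Y in covectors M, (Y != zerov) && confle Y X ==> (Y == X)]].

Definition topes : {set signvec T} :=
  [set X in covectors M | [forall Y in covectors M, confle X Y ==> (Y == X)]].

Definition loop (e : T) : bool :=
  (e \in ground M) && [forall X in covectors M, X e == Zero].

Definition coloop (e : T) : bool :=
  [exists X in cocircuits, supp X == [set e]].

End Covectors.

Section DiGraph.
Variables (V : finType) (D : {set V}) (arc : rel V).

Definition is_source (s : V) : bool :=
  (s \in D) && [forall v in D, ~~ arc v s].

Definition is_sink (t : V) : bool :=
  (t \in D) && [forall v in D, ~~ arc t v].

(* The vertices of the path are s :: p. *)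
Definition dipath (s t : V) (p : seq V) : bool :=
  [&& all (mem D) (s :: p), path arc s p, last s p == t & uniq (s :: p)].

Definition internal (s : V) (p : seq V) : seq V := behead (belast s p).

(* Injectivity of p matters: a single arc from s to t has no internal vertex, *)
(* so it would be disjoint from a repetition of itself.                       *)
Definition disjoint_dipaths (d : nat) (s t : V) : Prop :=
  exists p : 'I_d -> seq V,
    [/\ injective p,
        forall i, dipath s t (p i) &
        forall i j, i != j -> [disjoint internal s (p i) & internal s (p j)]].

Definition holt_klee (d : nat) : Prop :=
  exists s t : V,
    [/\ forall v, is_source v = (v == s),
        forall v, is_sink v = (v == t) &
        disjoint_dipaths d s t].

End DiGraph.

Section Program.
Variables (T : finType) (M : orientedMatroid T) (g f : T).

Definition om_program : bool :=
  [&& g \in ground M, ~~ loop M g, f \in ground M, f != g & ~~ coloop M f].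

Definition nonneg_constraints (X : signvec T) : bool :=
  [forall e in ground M :\: [set g; f], X e \in [:: Pos; Zero]].

Definition feasible : {set signvec T} :=
  [set X in covectors M | (X g == Pos) && nonneg_constraints X].

Definition unbounded : bool :=
  (feasible != set0) &&
  [exists X in covectors M,
     [&& X != zerov, X g == Zero & nonneg_constraints X]].

Definition bounded : bool := ~~ unbounded.

Definition full_dimensional : bool := [exists X in feasible, X \in topes M].

Definition Mf : orientedMatroid T := deletion M [set f].

Definition vertices : {set signvec T} :=
  [set V in cocircuits Mf | V g == Pos].

Definition edge (V1 V2 : signvec T) : bool :=
  [&& V1 \in vertices, V2 \in vertices, V1 != V2 &
   [exists Y in covectors Mf,
     [&& height (covectors Mf) Y == 2,
         [set V in cocircuits Mf | confle V Y] == [set V1; V2],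
         Y == compv V1 V2 & Y == compv V2 V1]]].

Definition eliminates (V1 V2 Z : signvec T) : bool :=
  [&& Z \in cocircuits Mf, Z g == Zero,
      [forall e, (Z e == Pos) ==> (V1 e == Neg) || (V2 e == Pos)] &
      [forall e, (Z e == Neg) ==> (V1 e == Pos) || (V2 e == Neg)]].

(* On an edge of a program, Z and its sign at f are unique, so edge_sign holds *)
(* for exactly one s.                                                          *)
Definition edge_sign (V1 V2 : signvec T) (s : sign) : bool :=
  [exists Z, eliminates V1 V2 Z && (setv Z f s \in cocircuits M)].

(* Exchanging V1 and V2 replaces Z by its opposite, so edge_sign V1 V2 Neg is  *)
(* edge_sign V2 V1 Pos.                                                        *)
Definition arc (V1 V2 : signvec T) : bool :=
  edge V1 V2 && edge_sign V1 V2 Pos.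

Definition vertices_plus : {set signvec T} :=
  [set V in vertices | nonneg_constraints V].

Definition generic : bool :=
  [forall V1 in vertices_plus, forall V2 in vertices_plus,
     edge V1 V2 ==> ~~ edge_sign V1 V2 Zero].

Definition proper_program : bool :=
  [&& om_program, bounded, full_dimensional & generic].

Definition HK_program : Prop := holt_klee vertices_plus arc (rank M).-1.

End Program.

Definition HK (T : finType) (M : orientedMatroid T) : Prop :=
  forall N, reoriented_minor M N ->
  forall f g, f \in ground N -> g \in ground N -> f != g ->
  proper_program N g f -> HK_program N g f.

(* Main.v *)
Require Import Defs.
From mathcomp Require Import all_boot.

(** The key object is the restriction [top] of a feasible tope to the elements
    other than the objective [f]. Full dimensionality makes it positive on all
    elements that are not loops, and boundedness makes the vertices of the
    feasible region exactly the cocircuits below it ([vertices_plusP]). The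
    region is therefore the interval below [top] in the face lattice, which has
    height [rank M] because [f] is not a coloop.

    In rank three this interval is a polygon. Intervals of length two in the
    face lattice of an oriented matroid have exactly two interior elements
    ([diamond], which rests on conformal elimination, [conformal_below]), so
    every vertex has exactly two neighbours ([two_neighbours3]). By genericity
    each edge has exactly one orientation, given by the sign at [f] of the
    covector at infinity that eliminates [g] between the opposite of one end
    and the other end ([edge_signE], [sarc_edge]).

    The line at infinity, that is, the contraction of [g], has rank two, so a
    point on it is determined up to sign by one zero ([line_unique]). There are
    two consequences. All directions from a sink to other vertices have the
    sign at [f] of the two edges at the sink ([sink_cone]), so that the
    direction between two sinks would have both signs: the sink is unique. And
    along a directed walk the directions of the arcs turn strictly
    monotonically within the half-line at infinity on one side of [f], so every
    walk ends in a sink ([reach_sink]). Reversing the objective gives the same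
    for sources.

    It remains to treat a graph with all degrees equal to two, oriented with
    one source and one sink ([holt_klee_polygon]). The two arcs at the source
    start two walks to the sink, and as every vertex other than the sink has
    at most one incoming arc, these walks cannot meet earlier. In rank two the
    feasible region is a segment, and in rank one it is a point. Since minors
    and reorientations do not increase the rank ([rank_minor]), all cases are
    covered. *)

Set Implicit Arguments.
Unset Strict Implicit.
Unset Printing Implicit Defensive.

(** * Sign vectors and the conformal order *)

Section ConformalOrder.
Variable T : finType.
Implicit Types X Y Z U V : signvec T.

(** The strict conformal order. *)
Definition ltv X Y : bool := confle X Y && (X != Y).

Lemma confleP X Y :
  reflect (forall e, X e != Zero -> Y e = X e) (confle X Y).
Proof.
apply: (iffP forallP) => H e.
  by move=> /negbTE nX; move: (H e); rewrite nX /= => /eqP.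
by case: eqP => //= /eqP /H ->.
Qed.

Lemma confle_refl : reflexive (@confle T).
Proof. by move=> X; apply/confleP. Qed.

Lemma confle_zero X Y e : confle X Y -> Y e = Zero -> X e = Zero.
Proof.
move=> /confleP XY Ye; apply/eqP; apply: contraT => nX.
by move: (nX); rewrite -(XY e nX) Ye.
Qed.

Lemma confle_trans : transitive (@confle T).
Proof.
move=> Y X Z /confleP XY /confleP YZ; apply/confleP => e nX.
by rewrite YZ XY.
Qed.

Lemma confle_anti X Y : confle X Y -> confle Y X -> X = Y.
Proof.
move=> /confleP XY /confleP YX; apply/ffunP => e.
have [X0|/XY //] := eqVneq (X e) Zero.
by have [->//|/YX] := eqVneq (Y e) Zero.
Qed.

Lemma ltv_irr : irreflexive ltv.
Proof. by move=> X; rewrite /ltv eqxx andbF. Qed.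

Lemma ltv_confle X Y : ltv X Y -> confle X Y.
Proof. by case/andP. Qed.

Lemma confle_ltv_trans Y X Z : confle X Y -> ltv Y Z -> ltv X Z.
Proof.
move=> XY /andP[YZ nYZ]; rewrite /ltv (confle_trans XY YZ) /=.
by apply: contra nYZ => /eqP eXZ; rewrite -eXZ in YZ *; rewrite (confle_anti XY YZ).
Qed.

Lemma ltv_trans : transitive ltv.
Proof. by move=> Y X Z /ltv_confle; apply: confle_ltv_trans. Qed.

Lemma confle0v X : confle zerov X.
Proof. by apply/confleP => e; rewrite ffunE. Qed.

Lemma confle_eq0 X Y : confle X Y -> Y = zerov -> X = zerov.
Proof. by move=> XY Y0; apply: confle_anti; rewrite ?confle0v // -Y0. Qed.

Lemma neq0P X : reflect (exists e, X e != Zero) (X != zerov).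
Proof.
apply: (iffP idP) => [|[e]]; last by apply: contraNneq => ->; rewrite ffunE.
have [/existsP|] := boolP [exists e, X e != Zero]; first by [].
move=> /existsPn X0 /eqP[]; apply/ffunP => e; rewrite ffunE.
by apply/eqP; rewrite -[_ == _]negbK X0.
Qed.

Lemma ltv_neq0 X Y : ltv X Y -> Y != zerov.
Proof.
case/andP=> XY; apply: contraNneq => Y0.
by rewrite (confle_eq0 XY Y0) Y0.
Qed.

Lemma zero_ltv X : X != zerov -> ltv zerov X.
Proof. by rewrite /ltv confle0v eq_sym. Qed.

Lemma ltv_witness X Y : ltv X Y -> exists2 e, X e = Zero & Y e != Zero.
Proof.
case/andP=> /confleP XY nXY.
have [/existsP[e /andP[/eqP Xe Ye]]|/existsPn H] :=
    boolP [exists e, (X e == Zero) && (Y e != Zero)]; first by exists e.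
case/eqP: nXY; apply/ffunP => e.
have [X0|/XY //] := eqVneq (X e) Zero.
by move: (H e); rewrite X0 eqxx negbK => /eqP.
Qed.

Lemma ltvI X Y e : confle X Y -> X e = Zero -> Y e != Zero -> ltv X Y.
Proof.
by move=> XY Xe Ye; rewrite /ltv XY; apply: contraNneq Ye => <-; rewrite Xe.
Qed.

Lemma oppvK : involutive (@oppv T).
Proof. by move=> X; apply/ffunP => e; rewrite !ffunE; case: (X e). Qed.

Lemma oppv_eq0 X : (oppv X == zerov) = (X == zerov).
Proof.
apply/eqP/eqP => [X0|->]; last by apply/ffunP => e; rewrite !ffunE.
by rewrite -[X]oppvK X0; apply/ffunP => e; rewrite !ffunE.
Qed.

Lemma compvE X Y e : compv X Y e = if X e == Zero then Y e else X e.
Proof. by rewrite ffunE. Qed.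

Lemma confle_compv X Y : confle X (compv X Y).
Proof. by apply/confleP => e /negbTE nX; rewrite ffunE nX. Qed.

Lemma compv_confle X Y Z : confle X Z -> confle Y Z -> confle (compv X Y) Z.
Proof.
move=> /confleP XZ /confleP YZ; apply/confleP => e; rewrite ffunE.
by case: ifP => [_ /YZ|_ /XZ].
Qed.

Lemma ltv_compv X Y e : X e = Zero -> Y e != Zero -> ltv X (compv X Y).
Proof.
by move=> Xe Ye; apply: (@ltvI _ _ e); rewrite ?confle_compv ?ffunE ?Xe.
Qed.

Lemma compv_absorb X Y : confle X Y -> compv X Y = Y.
Proof.
move=> /confleP XY; apply/ffunP => e; rewrite ffunE.
by case: ifP => // /negbT /XY.
Qed.

Lemma compv_below X Y Z : confle X Z -> confle Y Z -> compv X Y = compv Y X.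
Proof.
move=> /confleP XZ /confleP YZ; apply/ffunP => e; rewrite !ffunE.
have [X0|nX] := eqVneq (X e) Zero; have [Y0|nY] := eqVneq (Y e) Zero => //.
  by rewrite X0 Y0.
by rewrite -(XZ e) // (YZ e).
Qed.

End ConformalOrder.

Section Elimination.
Variables (T : finType) (M : orientedMatroid T).
Implicit Types X Y Z U V : signvec T.

Lemma elim_opp X Y e :
    X \in covectors M -> Y \in covectors M -> X e != Zero -> Y e = opps (X e) ->
  exists Z, [/\ Z \in covectors M, Z e = Zero,
    forall d, X d = Zero -> Z d = Y d,
    forall d, Y d = Zero -> Z d = X d &
    forall d, X d = Y d -> Z d = X d].
Proof.
move=> LX LY nX eY; have [|Z [LZ Ze ZE]] := covectorE LX LY (e := e).
  by rewrite /separates nX eY; case: (X e) nX.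
exists Z; split=> // d Xd; rewrite ZE /separates ?ffunE.
- by rewrite Xd.
- by rewrite Xd.
- by rewrite Xd; case: (X d).
- by rewrite Xd; case: (X d).
- by rewrite -Xd; case: (X d).
by rewrite -Xd; case: (X d).
Qed.

(** If neither vector vanishes at [e], then [e] can be eliminated between the *)
(** first one and the second one or its opposite.                             *)
Lemma elim_pm X Y e :
    X \in covectors M -> Y \in covectors M -> X e != Zero -> Y e != Zero ->
  exists Z, [/\ Z \in covectors M, Z e = Zero,
    forall d, Y d = Zero -> Z d = X d &
    forall d, X d = Zero -> Z d = Zero <-> Y d = Zero].
Proof.
move=> LX LY nX nY.
have [eY|neY] := eqVneq (Y e) (opps (X e)).
  have [Z [LZ Ze Z1 Z2 _]] := elim_opp LX LY nX eY.
  by exists Z; split=> // d Xd; rewrite Z1.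
have [|Z [LZ Ze Z1 Z2 _]] := elim_opp LX (covectorN LY) nX (e := e).
  by rewrite ffunE; move: nX nY neY; case: (X e); case: (Y e).
exists Z; split=> // d Xd; first by rewrite Z2 // ffunE Xd.
by rewrite Z1 // ffunE; case: (Y d).
Qed.

(** The conformal elimination theorem: a covector [U] whose support is        *)
(** properly contained in that of [Y] can be pushed below [Y], keeping the    *)
(** entries on which [U] and [Y] agree, in particular those of a common lower *)
(** bound [X].                                                                *)
Lemma conformal_below X U Y e0 :
    X \in covectors M -> U \in covectors M -> Y \in covectors M ->
    confle X U -> confle X Y -> U != X ->
    (forall e, Y e = Zero -> U e = Zero) -> U e0 = Zero -> Y e0 != Zero ->
  exists U', [/\ U' \in covectors M, ltv X U', ltv U' Y &
    forall e, U e = Y e -> U' e = Y e].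
Proof.
move=> LX + LY + XY.
have [n] := ubnP #|[set e | separates U Y e]|.
elim: n U e0 => // n IH U e0 len LU XU nUX sUY Ue0 Ye0.
have [sep0|] := eqVneq [set e | separates U Y e] set0.
  have UY e : U e != Zero -> Y e = U e.
    move=> nU; have := in_set0 e; rewrite -sep0 inE /separates nU /=.
    have : Y e != Zero by apply: contraNneq nU => /sUY ->.
    by move: nU; case: (U e); case: (Y e).
  exists U; split=> //; first by rewrite /ltv XU eq_sym.
  by apply: (@ltvI _ _ _ e0) => //; apply/confleP.
case/set0Pn=> e; rewrite inE => sep_e.
have [Z [LZ Ze ZE]] := covectorE LU LY sep_e.
have ZUY d : U d = Y d -> Z d = Y d.
  by move=> UYd; rewrite ZE ?ffunE /separates UYd; case: (Y d).
have ZX d : X d != Zero -> Z d = X d.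
  move=> nX; move/confleP: XU => /(_ _ nX) Ud; move/confleP: XY => /(_ _ nX) Yd.
  by rewrite ZUY ?Ud ?Yd.
have Ze0 : Z e0 = Y e0 by rewrite ZE ?ffunE /separates Ue0.
have Ye : Y e != Zero by move: sep_e; rewrite /separates; case: (U e); case: (Y e).
have [|//||||//|//|U' [LU' XU' U'Y U'E]] := IH Z e.
- rewrite -ltnS; apply: leq_trans len; apply: proper_card.
  apply/properP; split; last by exists e; rewrite inE ?sep_e // /separates Ze.
  apply/subsetP => d; rewrite !inE; apply: contraLR => nsep.
  by rewrite {1}/separates ZE // ffunE; move: nsep;
     rewrite /separates; case: (U d); case: (Y d).
- by apply/confleP.
- apply: contraNneq Ye0 => ZX0; rewrite -Ze0 ZX0.
  by rewrite (confle_zero XU Ue0).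
- by move=> d Yd; rewrite ZUY // Yd sUY.
exists U'; split=> // d Ud; apply: U'E; exact: ZUY.
Qed.

(** Two nonzero covectors in a flat on which no two nonzero covectors are     *)
(** comparable coincide up to sign.                                           *)
Lemma pm_unique (B : {set T}) X X' :
    (forall D D', D \in covectors M -> D' \in covectors M ->
       (forall e, e \in B -> D e = Zero) -> (forall e, e \in B -> D' e = Zero) ->
       D != zerov -> ~~ ltv D D') ->
    X \in covectors M -> X' \in covectors M -> X != zerov -> X' != zerov ->
    (forall e, e \in B -> X e = Zero) -> (forall e, e \in B -> X' e = Zero) ->
  X' = X \/ X' = oppv X.
Proof.
move=> flat LX LX' nX nX' XB X'B.
have comp0 (D D' : signvec T) : (forall e, e \in B -> D e = Zero) ->
    (forall e, e \in B -> D' e = Zero) -> forall e, e \in B -> compv D D' e = Zero.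
  by move=> DB DB' e Be; rewrite ffunE DB // DB'.
have sub (D D' : signvec T) e : D \in covectors M -> D' \in covectors M ->
    (forall d, d \in B -> D d = Zero) -> (forall d, d \in B -> D' d = Zero) ->
    D != zerov -> D e = Zero -> D' e = Zero.
  move=> LD LD' DB D'B nD De; apply/eqP; apply: contraT => nD'.
  by move: (flat _ _ LD (covectorC LD LD') DB (comp0 _ _ DB D'B) nD);
     rewrite (ltv_compv De nD').
have supp12 e : (X e == Zero) = (X' e == Zero).
  by apply/eqP/eqP; apply: sub.
have [->|neq] := eqVneq X' X; first by left.
right; apply/eqP; apply: contraT => nopp.
(* Equal supports: the vectors are opposite at [e] and agree at [d]. *)
have [e nXe /eqP nXX'] : exists2 e, X e != Zero & X' e != X e.
  have [/existsP[e /andP[]]|/existsPn H] :=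
    boolP [exists e, (X e != Zero) && (X' e != X e)]; first by exists e.
  case/eqP: neq; apply/ffunP => e; have := H e.
  by have := supp12 e; case: (X e); case: (X' e).
have [d nXd XX'd] : exists2 d, X d != Zero & X' d = X d.
  have [/existsP[d /andP[nd /eqP]]|/existsPn H] :=
    boolP [exists d, (X d != Zero) && (X' d == X d)]; first by exists d.
  case/eqP: nopp; apply/ffunP => a; have := H a; rewrite ffunE.
  by have := supp12 a; case: (X a); case: (X' a).
have [|Z [LZ Ze Z1 _ Z3]] := elim_opp LX LX' nXe.
  by have := supp12 e; case: (X e) nXX' nXe; case: (X' e).
have ZB a : a \in B -> Z a = Zero by move=> Ba; rewrite Z1 ?X'B ?XB.
have nZ : Z != zerov by apply/neq0P; exists d; rewrite Z3 // -XX'd.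
by rewrite (sub _ _ e LZ LX ZB XB nZ Ze) in nXe.
Qed.

(** The diamond property of the big face lattice: an interval of length two   *)
(** has exactly two elements in its interior.                                 *)
Lemma diamond X A Y :
    X \in covectors M -> A \in covectors M -> Y \in covectors M ->
    ltv X A -> ltv A Y ->
    (forall B C, B \in covectors M -> C \in covectors M ->
       ltv X B -> ltv B C -> ~~ ltv C Y) ->
  exists A', [/\ A' \in covectors M, ltv X A', ltv A' Y, A' != A &
    forall B, B \in covectors M -> ltv X B -> ltv B Y -> B = A \/ B = A'].
Proof.
move=> LX LA LY XA AY len2'.
have len2 B C : B \in covectors M -> C \in covectors M ->
    ltv X B -> ltv B C -> ltv C Y -> False.
  by move=> LB LC XB BC CY; have := len2' B C LB LC XB BC; rewrite CY.
have [leXA leAY] := (ltv_confle XA, ltv_confle AY).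
have [e Xe Ae] := ltv_witness XA; have [d Ad Yd] := ltv_witness AY.
have leXY := confle_trans leXA leAY.
(* The second element comes from crossing [A] to the far side of [X]. *)
have [A' [LA' XA' A'Y nAA']] : exists A', [/\ A' \in covectors M, ltv X A',
    ltv A' Y & A' d != Zero].
  set B := compv (compv X (oppv A)) Y.
  have LB : B \in covectors M by rewrite !covectorC ?covectorN.
  have XB : confle X B.
    by apply: confle_trans (confle_compv _ _); apply: confle_compv.
  have AYe := confleP _ _ leAY e Ae.
  have [||U [LU Ue U1 U2 U3]] := elim_opp LB LY (e := e).
  - by rewrite /B !ffunE Xe eqxx; case: (A e) Ae.
  - by rewrite /B !ffunE Xe eqxx AYe; case: (A e) Ae.
  have XAd : X d = Zero := confle_zero leXA Ad.
  have Bd : B d = Y d by rewrite /B !ffunE XAd eqxx Ad.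
  have XUle : confle X U.
    apply/confleP => a nX; have Xa := confleP _ _ XB a nX.
    by rewrite U3 // Xa (confleP _ _ leXY a nX).
  have [|||A' [LA' XA' A'Y A'E]] :=
      conformal_below LX LU LY XUle leXY _ _ Ue.
  - by apply: contraNneq Yd => UX; rewrite -Bd -(U3 d) // UX XAd.
  - move=> a Ya; rewrite U2 // /B !ffunE.
    by rewrite (confle_zero leXY Ya) (confle_zero leAY Ya).
  - by rewrite AYe.
  exists A'; split=> //; rewrite A'E //.
  by rewrite U3 // Bd.
exists A'; split=> //; first by apply: contraNneq nAA' => ->; rewrite Ad.
(* Zero sets of interior elements, relative to [Y], are pairwise disjoint. *)
have disj (B C : signvec T) a : B \in covectors M -> C \in covectors M ->
    ltv X B -> ltv B Y -> ltv X C -> ltv C Y ->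
    B != C -> B a = Zero -> Y a != Zero -> C a = Y a.
  move=> LB LC XB BY XC CY nBC Ba Ya.
  have [Ca|nCa] := eqVneq (C a) Zero; last first.
    by rewrite (confleP _ _ (ltv_confle CY) a nCa).
  have [CB|nCB] := boolP (confle C B).
    by case: (len2 _ _ LC LB XC _ BY); rewrite /ltv CB eq_sym nBC.
  have BCY : confle (compv B C) Y by apply: compv_confle; apply: ltv_confle.
  case: (len2 _ _ LB (covectorC LB LC) XB).
    rewrite /ltv confle_compv; apply: contraNneq nCB => BC.
    rewrite BC (compv_below (ltv_confle BY) (ltv_confle CY)).
    exact: confle_compv.
  by apply: (@ltvI _ _ _ a); rewrite // ffunE Ba.
move=> A3 LA3 XA3 A3Y.
have [->|nA3A] := eqVneq A3 A; first by left.
have [->|nA3A'] := eqVneq A3 A'; first by right.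
have nA'A : A' != A by apply: contraNneq nAA' => ->; rewrite Ad.
exfalso.
have [d' A'd' Yd'] := ltv_witness A'Y; have [c A3c Yc] := ltv_witness A3Y.
have Ac := disj _ _ _ LA3 LA XA3 A3Y XA AY nA3A A3c Yc.
have A'c := disj _ _ _ LA3 LA' XA3 A3Y XA' A'Y nA3A' A3c Yc.
have Ad' : A d' = Y d' by apply: (disj A').
have A'd : A' d = Y d by apply: (disj A) => //; rewrite eq_sym.
have A3d : A3 d = Y d by apply: (disj A) => //; rewrite eq_sym.
have A3d' : A3 d' = Y d' by apply: (disj A') => //; rewrite eq_sym.
have X0 (B : signvec T) a : ltv X B -> B a = Zero -> X a = Zero.
  by move=> /ltv_confle XB Ba; apply: (confle_zero XB).
have Y0 (B : signvec T) a : ltv B Y -> Y a = Zero -> B a = Zero.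
  by move=> /ltv_confle BY Ya; apply: (confle_zero BY).
(* [U] lies on the line of [A3], and is separated from it at [d]. *)
have [||U [LU Uc U1 U2 U3]] :=
    elim_opp LA (covectorC LX (covectorN LA')) (e := c).
- by rewrite Ac.
- by rewrite !ffunE (X0 _ _ XA3 A3c) eqxx A'c Ac.
have Ud : U d = opps (Y d) by rewrite U1 // !ffunE (X0 _ _ XA Ad) A'd.
have Ud' : U d' = Y d' by rewrite U2 ?Ad' // !ffunE (X0 _ _ XA' A'd') A'd'.
have XU : confle X U.
  apply/confleP => a nX; rewrite U3.
    exact: (confleP _ _ leXA).
  by rewrite ffunE (negbTE nX) (confleP _ _ leXA).
have UY a : Y a = Zero -> U a = Zero.
  move=> Ya; rewrite U1 ?(Y0 _ _ AY) // !ffunE (Y0 _ _ A'Y) //.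
  by rewrite (X0 _ _ XA (Y0 _ _ AY Ya)).
have UA3 a : A3 a = Zero -> U a = Zero.
  move=> A3a; apply/eqP; apply: contraT => nUa.
  have [|||//|V [LV A3V VY _]] :=
    conformal_below (e0 := c) LA3 (covectorC LA3 LU) LY (confle_compv _ _)
      (ltv_confle A3Y).
  - by have /andP[_] := ltv_compv A3a nUa; rewrite eq_sym.
  - by move=> b Yb; rewrite ffunE (Y0 _ _ A3Y) // UY.
  - by rewrite ffunE A3c.
  by case: (len2 _ _ LA3 LV XA3 A3V).
have [||V [LV Vd V1 V2 V3]] := elim_opp LU LA3 (e := d).
- by rewrite Ud; case: (Y d) Yd.
- by rewrite Ud A3d; case: (Y d).
have [|||||W [LW XW WA3 _]] :=
    conformal_below (e0 := d) LX LV LA3 _ (ltv_confle XA3).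
- apply/confleP => a nX; rewrite V3 (confleP _ _ XU) //.
  by rewrite (confleP _ _ (ltv_confle XA3)).
- apply: contraNneq Yd' => VX.
  by rewrite -Ud' -(V3 d') ?Ud' ?A3d' // VX (X0 _ _ XA' A'd').
- by move=> a A3a; rewrite V2 // UA3.
- exact: Vd.
- by rewrite A3d.
by case: (len2 _ _ LW LA3 XW WA3).
Qed.

End Elimination.

(** * Chains, height and rank *)

Section Chains.
Variable T : finType.
Implicit Types (X Y : signvec T) (L : {set signvec T}).

(** A strictly increasing sequence of nonzero members of [L]. *)
Definition chain_in L (s : seq (signvec T)) : bool :=
  sorted (@ltv T) s && all (fun X => (X \in L) && (X != zerov)) s.

Lemma height_geP L X k :
  reflect (exists s, [/\ chain_in L s, all (fun Y => confle Y X) s & size s = k])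
          (k <= height L X).
Proof.
apply: (iffP idP) => [|[s [/andP[srt /allP Ls] /allP sX <-]]]; last first.
  have us : uniq s := sorted_uniq (@ltv_trans T) (@ltv_irr T) srt.
  have /card_uniqP <- := us.
  rewrite -(eq_card (_ : [set Y in s] =i s)); last by move=> Y; rewrite inE.
  apply: (@leq_bigmax_cond _ _ (fun C : {set signvec T} => #|C|)).
  apply/andP; split; last first.
    by apply/subsetP => Y; rewrite !inE => sY; have /andP[-> ->] := Ls Y sY; rewrite sX.
  apply/forall_inP => Y; rewrite inE => sY.
  apply/forall_inP => Z; rewrite inE => sZ.
  have lt_ij i j : i < j -> j < size s -> ltv (nth zerov s i) (nth zerov s j).
    move=> ij js; apply: (sorted_ltn_nth (@ltv_trans T) zerov srt) => //.
    by rewrite inE (ltn_trans ij).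
  rewrite -(nth_index zerov sY) -(nth_index zerov sZ).
  case: (ltngtP (index Y s) (index Z s)) => [ij|ji|->].
  - by rewrite (ltv_confle (lt_ij _ _ ij _)) ?index_mem.
  - by rewrite (ltv_confle (lt_ij _ _ ji _)) ?index_mem ?orbT.
  by rewrite confle_refl.
pose P (C : {set signvec T}) := is_chain C &&
  (C \subset [set Y in L | (Y != zerov) && confle Y X]).
have [|C PC eqC] := @eq_bigmax_cond _ (mem P) (fun C : {set signvec T} => #|C|).
  apply/card_gt0P; exists set0; apply/andP; split; last exact: sub0set.
  by apply/forall_inP => Y; rewrite inE.
rewrite /height (_ : \max_(_ | _) _ = #|C|) // => leC.
case/andP: PC => /forall_inP chC /subsetP CL.
pose s := sort (@confle T) (enum C).
have mem_s Y : (Y \in s) = (Y \in C) by rewrite mem_sort mem_enum.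
have srt : sorted (@ltv T) s.
  have : sorted (@confle T) s.
    apply: (sort_sorted_in (P := mem C)) => [Y Z CY CZ|].
      by have /forall_inP := chC Y CY; apply.
    by apply/allP => Y; rewrite mem_enum.
  have : uniq s by rewrite sort_uniq enum_uniq.
  rewrite uniq_pairwise !sorted_pairwise; [|exact: ltv_trans|exact: confle_trans].
  by move=> us cs; rewrite /ltv pairwise_relI cs us.
exists (take k s); split.
- rewrite /chain_in take_sorted //; apply/allP => Y /mem_take.
  by rewrite mem_s => /CL; rewrite !inE => /and3P[-> ->].
- apply/allP => Y /mem_take.
  by rewrite mem_s => /CL; rewrite !inE => /and3P[].
by rewrite size_takel // size_sort -cardE.
Qed.

Lemma chain_last L X s : chain_in L (X :: s) ->
  [/\ last X s \in L, last X s != zerov &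
      all (fun Y => confle Y (last X s)) (X :: s)].
Proof.
case/andP=> srt /allP Ls.
have /andP[-> ->] := Ls _ (mem_last X s); split=> //=.
elim: s X srt {Ls} => [|Y s IH] X /=; first by rewrite confle_refl.
case/andP=> XY /IH /andP[Yl ->]; rewrite andbT Yl.
by rewrite (confle_trans (ltv_confle XY) Yl).
Qed.

Variable M : orientedMatroid T.

Lemma rank_geP k :
  reflect (exists2 s, chain_in (covectors M) s & size s = k) (k <= rank M).
Proof.
apply: (iffP idP) => [|[[|X s] chs <-] //]; last first.
  have [Ll _ sl] := chain_last chs.
  apply: leq_trans (leq_bigmax_cond _ Ll); apply/height_geP.
  by exists (X :: s).
case: k => [_|k]; first by exists [::].
have [|X LX eX] :=
  @eq_bigmax_cond _ (mem (covectors M)) (height (covectors M)).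
  by apply/card_gt0P; exists zerov; apply: covector0.
rewrite /rank (_ : \max_(_ in _) _ = height (covectors M) X) //.
by case/height_geP=> s [chs _ sz]; exists s.
Qed.

Lemma rank1_chain : rank M <= 1 -> forall X Y,
  X \in covectors M -> Y \in covectors M -> X != zerov -> ~~ ltv X Y.
Proof.
move=> r1 X Y LX LY nX; apply/negP => XY.
suff /leq_trans/(_ r1) : 2 <= rank M by [].
apply/rank_geP; exists [:: X; Y] => //.
by rewrite /chain_in /= XY LX LY nX (ltv_neq0 XY).
Qed.

Lemma rank2_chain : rank M <= 2 -> forall X Y Z,
  X \in covectors M -> Y \in covectors M -> Z \in covectors M ->
  X != zerov -> ltv X Y -> ~~ ltv Y Z.
Proof.
move=> r2 X Y Z LX LY LZ nX XY; apply/negP => YZ.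
suff /leq_trans/(_ r2) : 3 <= rank M by [].
apply/rank_geP; exists [:: X; Y; Z] => //.
by rewrite /chain_in /= XY YZ LX LY LZ nX (ltv_neq0 XY) (ltv_neq0 YZ).
Qed.

Lemma rank3_chain : rank M <= 3 -> forall X Y Z U,
  X \in covectors M -> Y \in covectors M -> Z \in covectors M ->
  U \in covectors M -> X != zerov -> ltv X Y -> ltv Y Z -> ~~ ltv Z U.
Proof.
move=> r2 X Y Z U LX LY LZ LU nX XY YZ; apply/negP => ZU.
suff /leq_trans/(_ r2) : 4 <= rank M by [].
apply/rank_geP; exists [:: X; Y; Z; U] => //.
by rewrite /chain_in /= XY YZ ZU LX LY LZ LU nX (ltv_neq0 XY) (ltv_neq0 YZ)
  (ltv_neq0 ZU).
Qed.

(** In rank two, at most one opposite pair of nonzero covectors vanishes at a *)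
(** given nonloop.                                                            *)
Lemma point_unique p P X X' : rank M <= 2 ->
    P \in covectors M -> P p != Zero ->
    X \in covectors M -> X' \in covectors M -> X != zerov -> X' != zerov ->
    X p = Zero -> X' p = Zero ->
  X' = X \/ X' = oppv X.
Proof.
move=> r2 LP Pp LX LX' nX nX' Xp X'p.
apply: (pm_unique (B := [set p])) LX LX' nX nX' _ _ => [D D' LD LD' _ D'p nD| |].
- apply/negP => DD'; have /negP[] := rank2_chain r2 LD LD' (covectorC LD' LP) nD DD'.
  by apply: ltv_compv Pp; apply: D'p; rewrite inE.
- by move=> e /set1P->.
- by move=> e /set1P->.
Qed.

(** In rank three, at most one opposite pair of nonzero covectors vanishes at *)
(** two given independent elements.                                           *)
Lemma line_unique p q P Q X X' : rank M <= 3 ->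
    P \in covectors M -> Q \in covectors M ->
    P p != Zero -> P q = Zero -> Q q != Zero ->
    X \in covectors M -> X' \in covectors M -> X != zerov -> X' != zerov ->
    X p = Zero -> X q = Zero -> X' p = Zero -> X' q = Zero ->
  X' = X \/ X' = oppv X.
Proof.
move=> r3 LP LQ Pp Pq Qq LX LX' nX nX' Xp Xq X'p X'q.
apply: (pm_unique (B := [set p; q])) LX LX' nX nX' _ _ => [D D' LD LD' _ D'0 nD| |].
- apply/negP => DD'.
  have D'p : D' p = Zero by apply: D'0; rewrite !inE eqxx.
  have D'q : D' q = Zero by apply: D'0; rewrite !inE eqxx orbT.
  have LD'P := covectorC LD' LP.
  have /negP[] := rank3_chain r3 LD LD' LD'P (covectorC LD'P LQ) nD DD' (ltv_compv D'p Pp).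
  by apply: (ltv_compv (e := q)); rewrite // ffunE D'q.
- by move=> e /set2P[]->.
- by move=> e /set2P[]->.
Qed.

Lemma cocircuitP X :
  reflect [/\ X \in covectors M, X != zerov & forall Y, Y \in covectors M ->
              Y != zerov -> confle Y X -> Y = X]
          (X \in cocircuits M).
Proof.
rewrite inE; apply: (iffP and3P) => -[LX nX minX]; split=> //.
  by move=> Y LY nY YX; have /implyP := forall_inP minX Y LY; rewrite nY => /(_ YX)/eqP.
by apply/forall_inP => Y LY; apply/implyP => /andP[nY /minX->].
Qed.

Lemma cocircuit_below X : X \in covectors M -> X != zerov ->
  exists2 V, V \in cocircuits M & confle V X.
Proof.
have [n] := ubnP #|supp X|; elim: n X => // n IH X len LX nX.
have [XC|] := boolP (X \in cocircuits M); first by exists X; rewrite ?confle_refl.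
rewrite inE LX nX /= => /forall_inPn[Y LY].
rewrite negb_imply => /andP[/andP[nY YX] nYX].
have ltYX : ltv Y X by rewrite /ltv YX.
have [|//|//|V CV VY] := IH Y; last by exists V; rewrite // (confle_trans VY).
rewrite -ltnS; apply: leq_trans len; apply: proper_card; apply/properP.
have [e Ye Xe] := ltv_witness ltYX; split; last by exists e; rewrite !inE ?Ye.
by apply/subsetP => d; rewrite !inE; apply: contraNneq => /(confle_zero YX)->.
Qed.

Lemma not_cocircuit X Y : X \in covectors M -> X != zerov -> ltv X Y ->
  Y \notin cocircuits M.
Proof.
move=> LX nX XY; apply/negP => /cocircuitP[_ _ /(_ X LX nX (ltv_confle XY)) eX].
by rewrite eX ltv_irr in XY.
Qed.

End Chains.

Section ElimRank.
Variables (T : finType) (M : orientedMatroid T).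
Implicit Types X Y Z U V D : signvec T.

(** If [X] is strictly below [Y], eliminating an element between [- X] and    *)
(** [Y] keeps the entries of [Y] outside the support of [X].                  *)
Lemma elim_lt X Y a : X \in covectors M -> Y \in covectors M ->
    ltv X Y -> X a != Zero ->
  exists Z, [/\ Z \in covectors M, Z a = Zero, Z != zerov,
    forall d, X d = Zero -> Z d = Y d & forall d, Y d = Zero -> Z d = Zero].
Proof.
move=> LX LY XY Xa; have leXY := ltv_confle XY.
have [||Z [LZ Za Z1 Z2 _]] := elim_opp (covectorN LX) LY (e := a).
- by rewrite ffunE; case: (X a) Xa.
- by rewrite ffunE (confleP _ _ leXY) //; case: (X a).
have ZY d : X d = Zero -> Z d = Y d by move=> Xd; rewrite Z1 // ffunE Xd.
exists Z; split=> //.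
  by have [e Xe Ye] := ltv_witness XY; apply/neq0P; exists e; rewrite ZY.
by move=> d Yd; rewrite Z2 // ffunE (confle_zero leXY Yd).
Qed.

(** If only the zero covector vanishes at both of two elements, the rank is   *)
(** at most two.                                                              *)
Lemma rank_le2 a b :
    (forall D, D \in covectors M -> D a = Zero -> D b = Zero -> D = zerov) ->
  rank M <= 2.
Proof.
move=> span; rewrite leqNgt; apply/negP => /rank_geP[s].
case: s => [|X [|Y [|Z [|? ?]]]] //=.
case/andP=> /and3P[XY YZ _] /and4P[/andP[LX nX] /andP[LY nY] /andP[LZ nZ] _] _.
(* A comparable pair of nonzero covectors vanishing at [a]. *)
have [D [D' [LD LD' nD DD' [Da D'a]]]] : exists D D', [/\ D \in covectors M,
    D' \in covectors M, D != zerov, ltv D D' & D a = Zero /\ D' a = Zero].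
  have [Ya|Ya] := eqVneq (Y a) Zero.
    by exists X, Y; split=> //; split=> //; apply: confle_zero (ltv_confle XY) Ya.
  have [d Yd Zd] := ltv_witness YZ.
  have [Xa|Xa] := eqVneq (X a) Zero.
    have [W [LW Wa _ W1 _]] := elim_lt LY LZ YZ Ya.
    exists X, (compv X W); split=> //; first exact: covectorC.
      apply: (@ltv_compv _ _ _ d); first exact: confle_zero (ltv_confle XY) Yd.
      by rewrite W1.
    by split=> //; rewrite ffunE Xa eqxx.
  have [W [LW Wa nW W1 W2]] := elim_lt LX LY XY Xa.
  have [W' [LW' W'a _ W1' _]] := elim_lt LX LZ (ltv_trans XY YZ) Xa.
  exists W, (compv W W'); split=> //; first exact: covectorC.
    apply: (@ltv_compv _ _ _ d); first exact: W2.
    by rewrite W1' //; apply: confle_zero (ltv_confle XY) Yd.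
  by split=> //; rewrite ffunE Wa eqxx.
have [Db|Db] := eqVneq (D b) Zero; first by case/eqP: nD; apply: span.
have [W [LW Wb nW _ W2]] := elim_lt LD LD' DD' Db.
by case/eqP: nW; apply: span => //; apply: W2.
Qed.

End ElimRank.

Section RankMinors.
Variable T : finType.
Implicit Types (M N : orientedMatroid T) (A : {set T}).

(** A chain of restrictions is lifted by composing lifts of its members.      *)
Lemma rank_deletion M A : rank (deletion M A) <= rank M.
Proof.
suff lift k : k <= rank (deletion M A) -> k <= rank M by apply: lift.
case/rank_geP=> -[|X s] chs <- //; apply/rank_geP.
case/andP: chs => /= pth /andP[/andP[/imsetP[X' LX' eX] nX] Ls].
suff [s' [p' L' <-]] : exists s', [/\ path (@ltv T) X' s',
    all (fun Y => Y \in covectors M) s' & size s' = size s].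
  exists (X' :: s') => //; rewrite /chain_in /= p' LX' /=; apply/andP; split.
    by apply: contraNneq nX => X0; rewrite eX X0 restrictv0.
  have pa := order_path_min (@ltv_trans T) p'.
  by apply/allP => Y Ys; rewrite (allP L') // (ltv_neq0 (allP pa _ Ys)).
elim: s X X' pth eX LX' Ls {nX} => [|Y s IH] X X' /=; first by exists [::].
case/andP=> XY pth eX LX' /andP[/andP[/imsetP[Y' LY' eY] nY] Ls].
have eXY : Y = restrictv (ground M :\: A) (compv X' Y').
  by rewrite restrictvC -eX -eY (compv_absorb (ltv_confle XY)).
have LXY := covectorC LX' LY'.
have [s' [p' L' sz]] := IH Y _ pth eXY LXY Ls.
exists (compv X' Y' :: s'); rewrite /= p' LXY L' sz; split=> //.
rewrite andbT /ltv confle_compv; apply: contraTneq XY => eX'.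
by rewrite eX eXY -eX' ltv_irr.
Qed.

Lemma rank_le_subset M N : covectors N \subset covectors M -> rank N <= rank M.
Proof.
move=> /subsetP NM.
suff lift k : k <= rank N -> k <= rank M by apply: lift.
case/rank_geP=> s /andP[srt /allP Ls] <-; apply/rank_geP; exists s => //.
by rewrite /chain_in srt; apply/allP => Y /Ls/andP[/NM -> ->].
Qed.

Lemma rank_contraction M A : rank (contraction M A) <= rank M.
Proof.
apply: rank_le_subset; apply/subsetP => X /imsetP[X' /setIdP[LX /forall_inP X0] ->].
suff -> : restrictv (ground M :\: A) X' = X' by [].
apply/ffunP => e; rewrite ffunE inE.
have [/X0/eqP-> //|_ /=] := boolP (e \in A).
by case: (boolP (e \in ground M)) => // /(covector_off LX).
Qed.

Lemma flipvK A : involutive (@flipv T A).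
Proof. by move=> X; apply/ffunP => e; rewrite !ffunE; case: (e \in A); case: (X e). Qed.

Lemma confle_flipv A X Y : confle X Y -> confle (flipv A X) (flipv A Y).
Proof.
move=> /confleP XY; apply/confleP => e; rewrite !ffunE.
by move: (XY e); case: ifP => _; case: (X e) => // ->.
Qed.

Lemma rank_reorientation M A : rank (reorientation M A) <= rank M.
Proof.
suff lift k : k <= rank (reorientation M A) -> k <= rank M by apply: lift.
case/rank_geP=> s /andP[srt /allP Ls] <-; apply/rank_geP.
exists (map (flipv A) s); last by rewrite size_map.
rewrite /chain_in sorted_map; apply/andP; split.
  apply: sub_sorted srt => X Y /andP[XY nXY].
  by rewrite /= /ltv confle_flipv // (inj_eq (inv_inj (@flipvK A))).
apply/allP => _ /mapP[X /Ls/andP[/imsetP[X' LX' ->] nX] ->].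
rewrite flipvK LX'; apply: contraNneq nX => ->.
by rewrite flipv0.
Qed.

Lemma rank_minor M N : reoriented_minor M N -> rank N <= rank M.
Proof.
elim=> // {}N A _ NM; apply: leq_trans NM.
- exact: rank_reorientation.
- exact: rank_deletion.
exact: rank_contraction.
Qed.

End RankMinors.

(** * Oriented polygons *)

(** In this part, [D] is the vertex set of an oriented simple graph all of    *)
(** whose vertices have degree two.                                           *)
Section Polygon.
Variables (V : finType) (D : {set V}) (arc : rel V).

Lemma sourceP s :
  reflect (s \in D /\ forall v, v \in D -> ~~ arc v s) (is_source D arc s).
Proof. by apply: (iffP andP) => -[Ds /forall_inP]. Qed.

Lemma sinkP t :
  reflect (t \in D /\ forall v, v \in D -> ~~ arc t v) (is_sink D arc t).
Proof. by apply: (iffP andP) => -[Dt /forall_inP]. Qed.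

Hypothesis arc_asym : {in D &, forall u v, arc u v -> ~~ arc v u}.

Hypothesis two_neighbours : {in D, forall v, exists w1 w2,
  [/\ w1 \in D, w2 \in D, w1 != w2 &
      {in D, forall w, arc v w || arc w v = ((w == w1) || (w == w2))}]}.

Lemma indegree_le1 x u v : x \in D -> u \in D -> v \in D ->
  ~~ is_sink D arc x -> arc u x -> arc v x -> u = v.
Proof.
move=> Dx Du Dv; rewrite /is_sink Dx /= => /forall_inPn[w Dw].
rewrite negbK => xw ux vx.
have [w1 [w2 [_ _ nw adj]]] := two_neighbours Dx.
have nuw : u != w by apply: contraNneq (arc_asym Du Dx ux) => ->.
have nvw : v != w by apply: contraNneq (arc_asym Dv Dx vx) => ->.
move: (adj w Dw) (adj u Du) (adj v Dv); rewrite xw ux vx !orbT.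
by case/esym/orP=> /eqP ew /esym/orP[]/eqP eu /esym/orP[]/eqP ev;
  move/eqP: nuw; move/eqP: nvw; congruence.
Qed.

(** A walk from a source is determined by its end, unless it ends in a sink:  *)
(** it can be traced back, since every vertex but the sinks has at most one   *)
(** incoming arc.                                                             *)
Lemma walk_unique s p q : is_source D arc s -> ~~ is_sink D arc (last s p) ->
    path arc s p -> path arc s q -> all (mem D) p -> all (mem D) q ->
  last s p = last s q -> p = q.
Proof.
move=> /sourceP[Ds src]; elim/last_ind: p q => [|p x IH] q.
  case/lastP: q => // q y _ _; rewrite rcons_path all_rcons last_rcons /=.
  case/andP=> sq ay _ /andP[Dy Dq] sy; subst y.
  have Dl : last s q \in D.
    by case/lastP: q Dq {sq ay} => // q y; rewrite all_rcons last_rcons => /andP[].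
  by move: (src _ Dl); rewrite ay.
rewrite last_rcons rcons_path all_rcons => nx /andP[sp ax] + /andP[Dx Dp].
have Dl r : all (mem D) r -> last s r \in D.
  by case/lastP: r => // r y; rewrite all_rcons last_rcons => /andP[].
case/lastP: q => [_ _ /= xs|q y].
  by move: (src _ (Dl _ Dp)); rewrite -[X in arc _ X]xs ax.
rewrite rcons_path all_rcons last_rcons => /andP[sq ay] /andP[_ Dq] exy; subst y.
have ll := indegree_le1 Dx (Dl _ Dp) (Dl _ Dq) nx ax ay.
rewrite (IH q) //; apply/negP => /sinkP[_ /(_ x Dx)].
by rewrite ax.
Qed.

Hypothesis reach_sink : {in D &, forall u v, arc u v ->
  exists p, [/\ all (mem D) p, path arc v p & is_sink D arc (last v p)]}.

(** From the source, the two walks that leave it end at the sink and cannot   *)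
(** meet before.                                                              *)
Lemma holt_klee_polygon s t :
    (forall v, is_source D arc v = (v == s)) ->
    (forall v, is_sink D arc v = (v == t)) ->
  holt_klee D arc 2.
Proof.
move=> srcE snkE; exists s, t; split=> //.
have src_s : is_source D arc s by rewrite srcE.
have /sourceP[Ds src] := src_s.
have dip w : w \in D -> arc s w -> exists p,
    [/\ dipath D arc s t (w :: p), internal s (w :: p) = belast w p &
     forall x, x \in belast w p -> x != t /\ exists r, [/\ path arc s (w :: r),
       all (mem D) (w :: r) & last w r = x]].
  move=> Dw sw; have [p0 [Dp0 wp0 lp0]] := reach_sink Ds Dw sw.
  move: lp0; case/shortenP: wp0 => p wp up sub lp0.
  have Dp : all (mem D) p by apply/allP => x /sub; apply: (allP Dp0).
  have lp : last w p = t.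
    by apply/eqP; rewrite -snkE.
  have us : uniq (s :: w :: p).
    rewrite cons_uniq up andbT in_cons negb_or.
    have -> : s != w by apply: contraTneq sw => <-; apply: src.
    apply/negP => /splitPr sp; case: sp wp Dp => q1 q2.
    rewrite cat_path /= all_cat => /and3P[_ as_ _] /andP[Dq1 _].
    have Dl : last w q1 \in D.
      by have := mem_last w q1; rewrite inE => /predU1P[->|/(allP Dq1)].
    by move: (src _ Dl); rewrite as_.
  exists p; split=> //; first by rewrite /dipath us /= Ds Dw Dp sw wp lp eqxx.
  move=> x xp; split.
    apply: contraTneq xp => ->.
    by move: up; rewrite lastI rcons_uniq lp => /andP[].
  case/splitPl: (mem_belast xp) wp Dp => p1 p2 l1.
  rewrite cat_path all_cat => /andP[wp1 _] /andP[Dp1 _].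
  by exists p1; rewrite /= sw wp1 Dw.
have [w1 [w2 [Dw1 Dw2 nw adj]]] := two_neighbours Ds.
have out w : w \in D -> (w == w1) || (w == w2) -> arc s w.
  by move=> Dw; rewrite -adj // (negbTE (src w Dw)) orbF.
have [|p1 [dip1 int1 walk1]] := dip w1 Dw1; first by rewrite out ?eqxx.
have [|p2 [dip2 int2 walk2]] := dip w2 Dw2; first by rewrite out ?eqxx ?orbT.
have disj12 : [disjoint belast w1 p1 & belast w2 p2].
  rewrite disjoint_has; apply/hasPn => x /walk1[nxt [r1 [wr1 Dr1 lr1]]].
  apply/negP => /walk2[_ [r2 [wr2 Dr2 lr2]]].
  have [ew _] : w1 :: r1 = w2 :: r2; last by rewrite ew eqxx in nw.
  by apply: (walk_unique src_s) => //=; rewrite lr1 ?lr2 // snkE.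
exists (fun i : 'I_2 => if val i == 0 then w1 :: p1 else w2 :: p2); split.
- by case=> [[|[|//]] i2] [[|[|//]] j2] //= epp; try exact: val_inj;
    case: epp => ew; rewrite ew eqxx in nw.
- by move=> i; case: ifP.
case=> [[|[|//]] i2] [[|[|//]] j2] //= _; rewrite int1 int2 //.
by rewrite disjoint_sym.
Qed.
End Polygon.

(** * The covectors of a program *)

Section Program.
Variables (T : finType) (M : orientedMatroid T) (g f : T).
Implicit Types X Y Z U V W D u v w t : signvec T.

Local Notation N := (Mf M f).
Local Notation res := (restrictv (ground M :\: [set f])).

Lemma resE X e : X \in covectors M -> e != f -> res X e = X e.
Proof.
move=> LX nef; rewrite ffunE !inE nef /=.
by case: (boolP (e \in ground M)) => // /(covector_off LX).
Qed.

Lemma covector_f U : U \in covectors N -> U f = Zero.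
Proof. by move=> LU; rewrite (covector_off LU) // !inE eqxx. Qed.

Lemma covector_lift U : U \in covectors N ->
  exists2 X, X \in covectors M & forall e, e != f -> X e = U e.
Proof. by case/imsetP=> X LX ->; exists X => // e nef; rewrite resE. Qed.

Lemma covector_res X : X \in covectors M -> res X \in covectors N.
Proof. exact: imset_f. Qed.

Lemma covector_neqf U e : U \in covectors N -> U e != Zero -> e != f.
Proof. by move=> LU; apply: contraNneq => ->; rewrite covector_f. Qed.

Hypothesis fg : f != g.

(** [f] is not a coloop. *)
Hypothesis f_ncoloop :
  forall X, X \in covectors M -> (forall e, e != f -> X e = Zero) -> X = zerov.

(** The positive tope of the deletion of [f]. *)
Variable top : signvec T.
Hypothesis Ltop : top \in covectors N.
Hypothesis top_pos : forall e, top e != Zero -> top e = Pos.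
Hypothesis top_max : forall U e, U \in covectors N -> top e = Zero -> U e = Zero.
Hypothesis top_g : top g = Pos.

(** The program is bounded. *)
Hypothesis bnd : forall X, X \in covectors M -> X g = Zero ->
  (forall e, e != f -> X e = Zero \/ X e = Pos) -> X = zerov.

Lemma res_neq0 X : X \in covectors M -> X != zerov -> res X != zerov.
Proof.
move=> LX; apply: contraNneq => X0; apply/eqP/f_ncoloop => // e nef.
by rewrite -resE // X0 ffunE.
Qed.

Lemma below_top V : V \in covectors N ->
  (forall e, V e = Zero \/ V e = Pos) -> confle V top.
Proof.
move=> LV pV; apply/confleP => e nV.
have /top_pos-> : top e != Zero by apply: contraNneq nV => /top_max->.
by case: (pV e) nV => ->.
Qed.

Lemma top_belowP V e : confle V top -> V e != Zero -> V e = Pos.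
Proof.
move=> Vt nV; have te := confleP _ _ Vt e nV.
by rewrite -te top_pos // te.
Qed.

(** A positive tope that is itself a vertex forces the rank of the whole      *)
(** oriented matroid, and not only of the deletion, to be at most one.        *)
Lemma rank_top_cocircuit : top \in cocircuits N -> rank M <= 1.
Proof.
case/cocircuitP=> _ ntop mintop; rewrite leqNgt; apply/negP => /rank_geP[s].
case: s => [|X [|Y [|? ?]]] //=.
case/andP=> /andP[XY _] /and3P[/andP[LX nX] /andP[LY _] _] _.
have /neq0P[b] := res_neq0 LX nX.
move=> rb; have nbf := covector_neqf (covector_res LX) rb.
have [|Z [LZ Zb nZ _ _]] := elim_lt LX LY XY (a := b); first by rewrite -resE.
have [|||U [LU U0 Ut _]] := conformal_below (covector0 N) (covector_res LZ) Ltop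
  (confle0v _) (confle0v _) (res_neq0 LZ nZ) (e0 := b).
- by move=> e /top_max; apply; apply: covector_res.
- by rewrite resE.
- by apply: contraNneq rb => /top_max->; rewrite ?covector_res.
have eU := mintop _ LU (ltv_neq0 U0) (ltv_confle Ut).
by rewrite eU ltv_irr in Ut.
Qed.

(** Deleting [f] keeps the rank three, as [f] is not a coloop; the faces of   *)
(** the positive tope being graded, no vertex is then a facet.                *)
Lemma cocircuit_not_facet u : rank M = 3 -> u \in cocircuits N -> confle u top ->
  exists2 Y, Y \in covectors N & ltv u Y /\ ltv Y top.
Proof.
move=> r3 Cu leut; have /cocircuitP[Lu nu minu] := Cu.
have ut : ltv u top.
  rewrite /ltv leut; apply/eqP => eu; have := rank_top_cocircuit.
  by rewrite -eu Cu r3 => /(_ isT).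
have [a ua ta] := ltv_witness ut.
have [/exists_inP[Y LY /andP[]]|/exists_inPn no] :=
    boolP [exists Y in covectors N, ltv u Y && ltv Y top]; first by exists Y.
have /neq0P[b ub] := nu.
suff : rank M <= 2 by rewrite r3.
apply: (@rank_le2 _ M a b) => D LD Da Db.
have LrD := covector_res LD.
have naf := covector_neqf Ltop ta; have nbf := covector_neqf Lu ub.
have Du : compv u (res D) = u.
  apply/eqP; apply: contraT => nuU.
  have [|||U [LU uU Ut _]] := conformal_below Lu (covectorC Lu LrD) Ltop
    (confle_compv _ _) leut nuU (e0 := a) => //.
  - by move=> e te; rewrite ffunE (top_max Lu te) (top_max LrD te).
  - by rewrite ffunE ua eqxx resE.
  by have := no U LU; rewrite uU Ut.
have uD e : u e = Zero -> res D e = Zero.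
  by move=> ue; have := compvE u (res D) e; rewrite Du ue eqxx => <-.
apply/eqP; apply: contraT => /(res_neq0 LD) nD.
have [|||U [LU U0 Uu _]] := conformal_below (covector0 N) LrD Lu
    (confle0v _) (confle0v _) nD (e0 := b) => //.
  by rewrite resE.
have eU := minu _ LU (ltv_neq0 U0) (ltv_confle Uu).
by rewrite eU ltv_irr in Uu.
Qed.

(** By boundedness, the vertices of the feasible region are all the           *)
(** cocircuits below the positive tope.                                       *)
Lemma vertices_plusP v :
  reflect (v \in cocircuits N /\ confle v top) (v \in vertices_plus M g f).
Proof.
rewrite [v \in vertices_plus _ _ _]in_set [v \in vertices _ _ _]in_set -andbA.
have nnP : v \in covectors N -> v g = Pos ->
    nonneg_constraints M g f v = confle v top.
  move=> Lv vg; apply/forall_inP/idP => [pv|vt].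
    apply: below_top => // e.
    have [->|nef] := eqVneq e f; first by left; apply: covector_f.
    have [->|neg] := eqVneq e g; first by right.
    have [Ee|Ee] := boolP (e \in ground M).
      have : e \in ground M :\: [set g; f] by rewrite !inE negb_or neg nef.
      by move/pv; rewrite !inE => /orP[]/eqP->; [right|left].
    by left; rewrite (covector_off Lv) // !inE negb_and Ee orbT.
  move=> e _; rewrite !inE; have [->|/(top_belowP vt)->] := eqVneq (v e) Zero.
    by rewrite orbT.
  by rewrite eqxx.
apply: (iffP and3P) => [[Cv /eqP vg pv]|[Cv vt]].
  by split=> //; rewrite -nnP //; case/cocircuitP: Cv.
have /cocircuitP[Lv nv _] := Cv.
suff vg : v g = Pos by split; rewrite ?vg ?nnP.
apply: (top_belowP vt); apply: contraNneq nv => vg.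
have [X LX Xv] := covector_lift Lv.
have X0 : X = zerov.
  apply: bnd => // [|e nef]; first by rewrite Xv // eq_sym.
  rewrite Xv //; have [->|/(top_belowP vt)->] := eqVneq (v e) Zero.
    by left.
  by right.
apply/eqP/ffunP => e; have [->|nef] := eqVneq e f.
  by rewrite covector_f // ffunE.
by rewrite -Xv // X0.
Qed.

Local Notation VP := (vertices_plus M g f).

Lemma vertex_facts v : v \in VP -> [/\ v \in cocircuits N, v \in covectors N,
  v != zerov, confle v top & v g = Pos].
Proof.
move=> Vv; have /vertices_plusP[Cv vt] := Vv; have /cocircuitP[Lv nv _] := Cv.
by split=> //; move: Vv; rewrite !in_set => /andP[/andP[_ /eqP]].
Qed.

Lemma vertex_exists : exists u, u \in VP.
Proof.
have ntop : top != zerov by apply/neq0P; exists g; rewrite top_g.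
have [u Cu ut] := cocircuit_below Ltop ntop.
by exists u; apply/vertices_plusP.
Qed.

Lemma vertex_ltv u v : u \in VP -> v \in VP -> u != v -> ltv u (compv u v).
Proof.
move=> /vertex_facts[Cu Lu nu ut _] /vertex_facts[Cv Lv nv vt _] nuv.
rewrite /ltv confle_compv; apply: contraNneq nuv => eu.
have vu : confle v u by rewrite eu (compv_below ut vt) confle_compv.
have /cocircuitP[_ _ minu] := Cu.
by rewrite (minu v).
Qed.

Lemma edgeE u v : u \in VP -> v \in VP ->
  edge M g f u v = [&& u != v, height (covectors N) (compv u v) == 2 &
    [set V in cocircuits N | confle V (compv u v)] == [set u; v]].
Proof.
move=> Vu Vv; have [Cu Lu nu ut ug] := vertex_facts Vu.
have [Cv Lv nv vt vg] := vertex_facts Vv.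
have vertexE w : w \in VP -> w \in vertices M g f by rewrite in_set => /andP[].
rewrite /edge !vertexE // !andTb.
congr (_ && _); apply/exists_inP/andP => [[Y LY]|[h2 hs]].
  by case/and4P=> h2 hs /eqP<- _.
exists (compv u v); first exact: covectorC.
by apply/and4P; split=> //; rewrite (compv_below ut vt).
Qed.

(** * Directions of edges *)

(** [Z] is a direction from [u] to [v]: a covector obtained by eliminating    *)
(** [g] between [- u] and [v]. As covectors of the deletion, [u] and [v] are  *)
(** set to zero at [f] and say nothing about [Z f], the slope of the          *)
(** objective; hence the restriction to the other elements.                   *)
Definition direction u v Z : Prop :=
  [/\ Z \in covectors M, Z g = Zero,
      forall e, e != f -> u e = Zero -> Z e = v e &
      forall e, e != f -> v e = Zero -> Z e = opps (u e)].

Lemma direction_opp u v Z : direction u v Z -> direction v u (oppv Z).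
Proof.
case=> LZ Zg Z1 Z2; split; first exact: covectorN; rewrite ?ffunE ?Zg //.
  by move=> e nef ve; rewrite ffunE Z2 //; case: (u e).
by move=> e nef ue; rewrite ffunE Z1.
Qed.

Lemma direction_exists u v : u \in VP -> v \in VP -> exists Z, direction u v Z.
Proof.
move=> /vertex_facts[_ Lu _ _ ug] /vertex_facts[_ Lv _ _ vg].
have [X LX Xu] := covector_lift Lu; have [Y LY Yv] := covector_lift Lv.
have ngf : g != f by rewrite eq_sym.
have [||Z [LZ Zg Z1 Z2 _]] := elim_opp (covectorN LX) LY (e := g).
- by rewrite ffunE Xu // ug.
- by rewrite ffunE Xu // Yv // ug vg.
exists Z; split=> // e nef e0.
  by rewrite Z1 ?Yv // ffunE Xu // e0.
by rewrite Z2 ?Yv // ffunE Xu.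
Qed.

Lemma vertex_diff u v : u \in VP -> v \in VP -> u != v ->
  exists e, [/\ e != f, u e = Pos & v e = Zero].
Proof.
move=> Vu Vv; have [Cu Lu nu ut ug] := vertex_facts Vu.
have [Cv Lv nv vt vg] := vertex_facts Vv => nuv.
have [e ve] := ltv_witness (vertex_ltv Vv Vu (contra_neq (@esym _ _ _) nuv)).
rewrite ffunE ve eqxx => ue; exists e; split=> //.
  exact: covector_neqf ue.
exact: top_belowP ue.
Qed.

Lemma direction_neq0 u v Z : u \in VP -> v \in VP -> u != v ->
  direction u v Z -> Z != zerov.
Proof.
move=> Vu Vv nuv [_ _ _ Z2]; have [e [nef ue ve]] := vertex_diff Vu Vv nuv.
by apply/neq0P; exists e; rewrite Z2 // ue.
Qed.

(** The points at infinity of the span of [u] and [v] are unique up to sign:  *)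
(** this holds for the two ends of an edge, and makes its orientation         *)
(** well defined.                                                             *)
Definition aligned u v : Prop := forall X X',
  X \in covectors M -> X' \in covectors M -> X != zerov -> X' != zerov ->
  X g = Zero -> X' g = Zero ->
  (forall e, e != f -> u e = Zero -> v e = Zero -> X e = Zero) ->
  (forall e, e != f -> u e = Zero -> v e = Zero -> X' e = Zero) ->
  X' = X \/ X' = oppv X.

(** The sign of an edge is the value of the objective on its direction.       *)
Lemma edge_signE u v Z s : u \in VP -> v \in VP -> u != v -> aligned u v ->
  direction u v Z -> edge_sign M g f u v s = (Z f == s).
Proof.
move=> Vu Vv nuv al dZ; have [LZ Zg Z1 Z2] := dZ.
have [Cu Lu nu ut ug] := vertex_facts Vu; have [Cv Lv nv vt vg] := vertex_facts Vv.
have nZ := direction_neq0 Vu Vv nuv dZ.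
have ngf : g != f by rewrite eq_sym.
have [d [ndf ud vd]] := vertex_diff Vu Vv nuv.
have Zd : Z d = Neg by rewrite Z2 // ud.
have Z0 e : e != f -> u e = Zero -> v e = Zero -> Z e = Zero.
  by move=> nef ue ve; rewrite Z1.
(* Only [Z] itself is conformal to [Z] among the points of its line. *)
have conf X : X \in covectors M -> X != zerov ->
    (forall e, e != f -> X e != Zero -> X e = Z e) -> X = Z.
  move=> LX nX XZ; have X0 e : e != f -> Z e = Zero -> X e = Zero.
    move=> nef Ze; apply/eqP; apply: contraT => nXe.
    by move: (nXe); rewrite XZ // Ze.
  have [|e nef ue ve|->//|eX] := al Z X LZ LX nZ nX Zg _ Z0.
  - by apply: X0.
  - by apply: X0 => //; apply: Z0.
  have Xd : X d = Pos by rewrite eX ffunE Zd.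
  by move: (XZ d ndf); rewrite Xd Zd => /(_ isT).
apply/exists_inP/eqP => [[Z' /and4P[CZ' /eqP Z'g pZ' nZ']] CX|<-].
  have /cocircuitP[LZ' nZ'0 _] := CZ'.
  have /cocircuitP[LX nX _] := CX.
  have XE e : e != f -> setv Z' f s e = Z' e.
    by move=> nef; rewrite ffunE (negbTE nef).
  have X0 e : e != f -> u e = Zero -> v e = Zero -> setv Z' f s e = Zero.
    move=> nef ue ve; rewrite XE //.
    move: (forallP pZ' e) (forallP nZ' e); rewrite ue ve /=.
    by case: (Z' e).
  have [|<-|eX] := al Z _ LZ LX nZ nX Zg _ Z0 X0; first by rewrite XE.
    by rewrite ffunE eqxx.
  have Z'd : Z' d = Pos by rewrite -XE // eX ffunE Zd.
  by move: (forallP pZ' d); rewrite Z'd ud vd.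
exists (res Z); last first.
  have -> : setv (res Z) f (Z f) = Z.
    by apply/ffunP => e; rewrite ffunE; case: eqVneq => [->//|nef]; rewrite resE.
  apply/cocircuitP; split=> // Y LY nY /confleP YZ.
  by apply: conf => // e _ /YZ.
apply/and4P; split; last 1 first.
- apply/forallP => e; apply/implyP => /eqP rZe.
  have nef : e != f by apply: covector_neqf (covector_res LZ) _; rewrite rZe.
  move: rZe; rewrite resE // => Ze.
  have [ue|/(top_belowP ut)->//] := eqVneq (u e) Zero.
  by rewrite -Z1 // Ze orbT.
- apply/cocircuitP; split; [exact: covector_res|exact: res_neq0|].
  move=> Y LY nY /confleP YZ; have [X LX XY] := covector_lift LY.
  have eX : X = Z.
    apply: conf => // [|e nef].
      apply: contraNneq nY => X0; apply/eqP/ffunP => e.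
      have [->|nef] := eqVneq e f; first by rewrite covector_f // ffunE.
      by rewrite -XY // X0.
    by rewrite XY // => /YZ <-; rewrite resE.
  apply/ffunP => e; have [->|nef] := eqVneq e f.
    by rewrite !covector_f // covector_res.
  by rewrite -XY // eX resE.
- by rewrite resE // Zg.
apply/forallP => e; apply/implyP => /eqP rZe.
have nef : e != f by apply: covector_neqf (covector_res LZ) _; rewrite rZe.
move: rZe; rewrite resE // => Ze.
have [ve|/(top_belowP vt)->//] := eqVneq (v e) Zero; last by rewrite orbT.
by move: Ze; rewrite Z2 //; case: (u e).
Qed.

(** * The polygon of a program of rank three *)

Section RankThree.
Hypothesis r3 : rank M = 3.

Let rM : rank M <= 3. Proof. by rewrite r3. Qed.
Let rN : rank N <= 3. Proof. by rewrite -r3; apply: rank_deletion. Qed.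

Lemma no_chain4 X Y Z U : X \in covectors N -> Y \in covectors N ->
    Z \in covectors N -> U \in covectors N -> X != zerov ->
  ltv X Y -> ltv Y Z -> ltv Z U -> False.
Proof.
move=> LX LY LZ LU nX XY YZ ZU.
by have := rank3_chain rN LX LY LZ LU nX XY YZ; rewrite ZU.
Qed.

(** An edge of the polygon has exactly two vertices. *)
Lemma edge_ends u Y : u \in VP -> Y \in covectors N -> ltv u Y -> ltv Y top ->
  exists v, [/\ v \in VP, u != v, compv u v = Y &
    forall w, w \in VP -> confle w Y -> w = u \/ w = v].
Proof.
move=> Vu LY uY Yt; have [Cu Lu nu ut ug] := vertex_facts Vu.
have [|v [Lv v0 vY nvu two]] := diamond (covector0 N) Lu LY (zero_ltv nu) uY.
  move=> B C LB LC B0 BC; apply/negP => CY.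
  exact: (no_chain4 LB LC LY Ltop (ltv_neq0 B0) BC CY Yt).
have nv := ltv_neq0 v0; have leYt := ltv_confle Yt.
have Vv : v \in VP.
  apply/vertices_plusP; split; last exact: confle_trans (ltv_confle vY) leYt.
  apply/cocircuitP; split=> // B LB nB Bv; apply/eqP; apply: contraT => nBv.
  by case: (no_chain4 LB Lv LY Ltop nB _ vY Yt); rewrite /ltv Bv.
have nuv : u != v by rewrite eq_sym.
exists v; split=> //.
  apply/eqP; apply: contraT => nuvY.
  case: (no_chain4 Lu (covectorC Lu Lv) LY Ltop nu (vertex_ltv Vu Vv nuv) _ Yt).
  by rewrite /ltv nuvY andbT compv_confle // ltv_confle.
move=> w Vw wY; have [Cw Lw nw _ _] := vertex_facts Vw.
apply: two => //; first exact: zero_ltv.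
rewrite /ltv wY; apply: contraTneq Cw => ->.
exact: not_cocircuit uY.
Qed.

(** Two vertices span either an edge or the whole feasible region.            *)
Lemma edge3E u v : u \in VP -> v \in VP ->
  edge M g f u v = (u != v) && (compv u v != top).
Proof.
move=> Vu Vv; rewrite edgeE //; have [->//|nuv] := eqVneq u v.
have [Cu Lu nu ut ug] := vertex_facts Vu; have [Cv Lv nv vt vg] := vertex_facts Vv.
have uY := vertex_ltv Vu Vv nuv; have LY := covectorC Lu Lv.
have leYt : confle (compv u v) top by apply: compv_confle.
have [eY|nY] /= := eqVneq (compv u v) top.
  rewrite eY; apply/negP => /andP[/eqP h2 _].
  have [Y LY' [uY' Yt]] := cocircuit_not_facet r3 Cu ut.
  suff : 3 <= height (covectors N) top by rewrite h2.
  apply/height_geP; exists [:: u; Y; top]; split=> //.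
    rewrite /chain_in; apply/andP; split.
      by apply/and3P.
    by apply/and4P; split=> //; apply/andP; split=> //;
      [exact: ltv_neq0 uY'|exact: ltv_neq0 Yt].
  by apply/and4P; split; rewrite ?confle_refl // ltv_confle.
have Yt : ltv (compv u v) top by rewrite /ltv leYt.
apply/andP; split.
  rewrite eqn_leq; apply/andP; split; last first.
    apply/height_geP; exists [:: u; compv u v]; split=> //.
      rewrite /chain_in; apply/andP; split; first by rewrite /= uY.
      by apply/and3P; split=> //; apply/andP; split=> //; exact: ltv_neq0 uY.
    by apply/and3P; split; rewrite ?confle_refl // ltv_confle.
  rewrite leqNgt; apply/negP => /height_geP[[|A [|B [|C [|? ?]]]] []] //.
  case/andP=> /and3P[AB BC _] /and4P[/andP[LA nA] /andP[LB _] /andP[LC _] _].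
  case/and4P=> _ _ CY _ _.
  exact: (no_chain4 LA LB LC Ltop nA AB BC (confle_ltv_trans CY Yt)).
have [v' [Vv' _ eY two]] := edge_ends Vu LY uY Yt.
have vY : confle v (compv u v) by rewrite (compv_below ut vt) confle_compv.
have evv' : v = v' by case: (two v Vv vY) => // evu; rewrite evu eqxx in nuv.
apply/eqP/setP => w; apply/setIdP/set2P => [[Cw wY]|[]->].
- rewrite evv'; apply: two => //; apply/vertices_plusP; split=> //.
  exact: confle_trans leYt.
- by rewrite confle_compv.
by [].
Qed.

Lemma edgeC u v : u \in VP -> v \in VP -> edge M g f u v = edge M g f v u.
Proof.
move=> Vu Vv; rewrite !edge3E // eq_sym.
have [_ _ _ ut _] := vertex_facts Vu; have [_ _ _ vt _] := vertex_facts Vv.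
by rewrite (compv_below ut vt).
Qed.

(** By the diamond property, a vertex lies on two edges, and each of them has *)
(** one other end.                                                            *)
Lemma two_neighbours3 u : u \in VP -> exists w1 w2,
  [/\ w1 \in VP, w2 \in VP, w1 != w2 &
      {in VP, forall w, edge M g f u w = ((w == w1) || (w == w2))}].
Proof.
move=> Vu; have [Cu Lu nu ut ug] := vertex_facts Vu.
have [Y1 LY1 [uY1 Y1t]] := cocircuit_not_facet r3 Cu ut.
have [|Y2 [LY2 uY2 Y2t nY21 twoY]] := diamond Lu LY1 Ltop uY1 Y1t.
  move=> B C LB LC uB BC; apply/negP => Ct.
  exact: (no_chain4 Lu LB LC Ltop nu uB BC Ct).
have [w1 [Vw1 nuw1 eY1 two1]] := edge_ends Vu LY1 uY1 Y1t.
have [w2 [Vw2 nuw2 eY2 two2]] := edge_ends Vu LY2 uY2 Y2t.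
exists w1, w2; split=> //.
  by apply: contraNneq nY21 => e12; rewrite -eY1 -eY2 e12.
move=> w Vw; have [Cw Lw nw wt wg] := vertex_facts Vw.
rewrite edge3E //; apply/andP/orP => [[nuw nt]|[]/eqP->]; last 2 first.
- by rewrite nuw1 eY1; have /andP[_] := Y1t.
- by rewrite nuw2 eY2; have /andP[_] := Y2t.
have wY : confle w (compv u w) by rewrite (compv_below ut wt) confle_compv.
have nwu : w = u -> False by move=> ewu; rewrite ewu eqxx in nuw.
case: (twoY (compv u w)) => [|||eY|eY].
- exact: covectorC.
- exact: vertex_ltv.
- by rewrite /ltv nt compv_confle.
- by left; apply/eqP; case: (two1 w Vw) => //; rewrite -eY.
by right; apply/eqP; case: (two2 w Vw) => //; rewrite -eY.
Qed.

Lemma edge_support u v : u \in VP -> v \in VP -> edge M g f u v ->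
  exists a, [/\ a != f, u a = Zero, v a = Zero & top a != Zero].
Proof.
move=> Vu Vv; have [Cu Lu nu ut ug] := vertex_facts Vu.
have [Cv Lv nv vt vg] := vertex_facts Vv.
rewrite edge3E // => /andP[nuv nt].
have [|a ya ta] := @ltv_witness _ (compv u v) top.
  by rewrite /ltv nt compv_confle.
exists a; move: ya; rewrite ffunE; case: eqP => // ua va; split=> //.
exact: covector_neqf ta.
Qed.

(** Two edges at a vertex lie on different lines: the far end of the second   *)
(** is on the positive side of the first.                                     *)
Lemma edge_turn u v w a : u \in VP -> v \in VP -> w \in VP ->
    edge M g f u v -> edge M g f v w -> u != w ->
  u a = Zero -> v a = Zero -> top a != Zero -> w a = Pos.
Proof.
move=> Vu Vv Vw; have [Cu Lu nu ut ug] := vertex_facts Vu.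
have [Cv Lv nv vt vg] := vertex_facts Vv.
have [Cw Lw nw wt wg] := vertex_facts Vw.
rewrite !edge3E // => /andP[nuv _] /andP[nvw _] nuw ua va ta.
have [wa|/(top_belowP wt)//] := eqVneq (w a) Zero; exfalso.
have LY := covectorC Lu Lv; have uY := vertex_ltv Vu Vv nuv.
have Yt : ltv (compv u v) top.
  by apply: (@ltvI _ _ _ a); rewrite ?compv_confle // ffunE ua.
have [v' [Vv' _ _ two]] := edge_ends Vu LY uY Yt.
have nwY : ~~ confle w (compv u v).
  apply/negP => /(two w Vw).
  have vY : confle v (compv u v) by rewrite (compv_below ut vt) confle_compv.
  case: (two v Vv vY) => [evu|<-]; first by rewrite evu eqxx in nuv.
  by case=> eww; [rewrite eww eqxx in nuw|rewrite eww eqxx in nvw].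
apply: (no_chain4 Lu LY (covectorC LY Lw) Ltop nu uY).
  rewrite /ltv confle_compv; apply: contraNneq nwY => ->.
  by rewrite (compv_below (ltv_confle Yt) wt) confle_compv.
apply: (@ltvI _ _ _ a) => //; first by rewrite !compv_confle.
by rewrite !ffunE ua va.
Qed.

(** Two points at infinity on the line of an element [a] coincide up to sign. *)
Lemma infinity_unique u a X X' : u \in VP -> a != f -> u a = Zero ->
    top a != Zero -> X \in covectors M -> X' \in covectors M -> X != zerov ->
    X' != zerov -> X g = Zero -> X' g = Zero -> X a = Zero -> X' a = Zero ->
  X' = X \/ X' = oppv X.
Proof.
move=> Vu naf ua ta LX LX' nX nX' Xg X'g Xa X'a.
have [_ Lu _ _ ug] := vertex_facts Vu; have [U LU Uu] := covector_lift Lu.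
have [Q LQ Qt] := covector_lift Ltop.
apply: (line_unique (p := g) (q := a) rM LU LQ) => //.
- by rewrite Uu ?ug // eq_sym.
- by rewrite Uu.
by rewrite Qt.
Qed.

Lemma edge_aligned u v : u \in VP -> v \in VP -> edge M g f u v -> aligned u v.
Proof.
move=> Vu Vv uv X X' LX LX' nX nX' Xg X'g X0 X'0.
have [a [naf ua va ta]] := edge_support Vu Vv uv.
by apply: (infinity_unique Vu naf ua ta) => //; [apply: X0|apply: X'0].
Qed.

Lemma edge3_signE u v Z s : u \in VP -> v \in VP -> edge M g f u v ->
  direction u v Z -> edge_sign M g f u v s = (Z f == s).
Proof.
move=> Vu Vv uv; apply: edge_signE => //; last exact: edge_aligned.
by move: uv; rewrite edge3E // => /andP[].
Qed.

Hypothesis gen : generic M g f.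

Lemma direction_generic u v Z : u \in VP -> v \in VP -> edge M g f u v ->
  direction u v Z -> Z f != Zero.
Proof.
move=> Vu Vv uv dZ; rewrite -(edge3_signE Zero Vu Vv uv dZ).
by have /forall_inP/(_ v Vv)/implyP := forall_inP gen u Vu; apply.
Qed.

(** The orientation of the edges by the objective ([s = Pos]) or by its       *)
(** opposite ([s = Neg]).                                                     *)
Definition sarc s u v := edge M g f u v && edge_sign M g f u v s.

Lemma sarcE s u v Z : u \in VP -> v \in VP -> direction u v Z ->
  sarc s u v = edge M g f u v && (Z f == s).
Proof.
move=> Vu Vv dZ; rewrite /sarc; case: (boolP (edge _ _ _ _ _)) => //= uv.
exact: edge3_signE.
Qed.

Lemma sarc_opp s u v : u \in VP -> v \in VP -> sarc (opps s) u v = sarc s v u.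
Proof.
move=> Vu Vv; have [Z dZ] := direction_exists Vu Vv.
rewrite (sarcE _ Vu Vv dZ) (sarcE _ Vv Vu (direction_opp dZ)) edgeC // ffunE.
by congr (_ && _); case: (Z f); case: s.
Qed.

Lemma sarc_edge s u v : s != Zero -> u \in VP -> v \in VP ->
  sarc s u v || sarc s v u = edge M g f u v.
Proof.
move=> ns Vu Vv; have [Z dZ] := direction_exists Vu Vv.
rewrite -(sarc_opp s Vu Vv) !(sarcE _ Vu Vv dZ) -andb_orr.
case: (boolP (edge _ _ _ _ _)) => //= uv.
by have := direction_generic Vu Vv uv dZ; case: (Z f); case: s ns.
Qed.

Lemma sarc_asym s u v : s != Zero -> u \in VP -> v \in VP ->
  sarc s u v -> ~~ sarc s v u.
Proof.
move=> ns Vu Vv; have [Z dZ] := direction_exists Vu Vv.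
rewrite -(sarc_opp s Vu Vv) !(sarcE _ Vu Vv dZ) => /andP[_ /eqP->].
by rewrite negb_and; case: s ns => //= _; rewrite orbT.
Qed.

Section Orientation.
Variable s : sign.
Hypothesis ns : s != Zero.

(** At a sink of the polygon, the directions to all other vertices lie on the *)
(** side of [f] opposite to [s], like those of the two edges at the sink: the *)
(** latter span the cone of all feasible directions.                          *)
Lemma sink_cone t t' D : is_sink VP (sarc s) t -> t' \in VP -> t != t' ->
  direction t t' D -> D f = opps s.
Proof.
move=> /sinkP[Vt snk] Vt' ntt' dD; have [LD Dg D1 _] := dD.
have nD := direction_neq0 Vt Vt' ntt' dD.
have [w1 [w2 [Vw1 Vw2 nw adj]]] := two_neighbours3 Vt.
have e1 : edge M g f t w1 by rewrite adj // eqxx.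
have e2 : edge M g f t w2 by rewrite adj // eqxx orbT.
have dirf w Z : w \in VP -> edge M g f t w -> direction t w Z -> Z f = opps s.
  move=> Vw tw dZ; have := snk w Vw; rewrite (sarcE s Vt Vw dZ) tw /=.
  by have := direction_generic Vt Vw tw dZ; case: (Z f); case: s ns.
have [Z1 dZ1] := direction_exists Vt Vw1; have [Z2 dZ2] := direction_exists Vt Vw2.
have Z1f := dirf _ _ Vw1 e1 dZ1; have Z2f := dirf _ _ Vw2 e2 dZ2.
have [a1 [na1 ta1 wa1 pa1]] := edge_support Vt Vw1 e1.
have [a2 [na2 ta2 wa2 pa2]] := edge_support Vt Vw2 e2.
have w2a1 : w2 a1 = Pos.
  by apply: (edge_turn Vw1 Vt Vw2) => //; rewrite edgeC.
have w1a2 : w1 a2 = Pos.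
  by apply: (edge_turn Vw2 Vt Vw1) => //; rewrite 1?edgeC // eq_sym.
have [LZ1 Z1g Z1u _] := dZ1; have [LZ2 Z2g Z2u _] := dZ2.
have Z1a1 : Z1 a1 = Zero by rewrite Z1u.
have Z1a2 : Z1 a2 = Pos by rewrite Z1u.
have Z2a1 : Z2 a1 = Pos by rewrite Z2u.
have Z2a2 : Z2 a2 = Zero by rewrite Z2u.
have nZ1 : Z1 != zerov by apply/neq0P; exists a2; rewrite Z1a2.
have nZ2 : Z2 != zerov by apply/neq0P; exists a1; rewrite Z2a1.
have [_ _ _ t't _] := vertex_facts Vt'.
apply/eqP; apply: contraT => nDf.
(* If [D] vanished at [a], it would be [Z] or [- Z], but its sign at [f]     *)
(* excludes the former and its sign at [b] the latter.                       *)
have Da a b Z : a != f -> b != f -> t a = Zero -> t b = Zero -> top a != Zero ->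
    Z \in covectors M -> Z g = Zero -> Z != zerov -> Z f = opps s ->
    Z a = Zero -> Z b = Pos -> D a = Pos.
  move=> na nb ta tb pa LZ Zg nZ Zf Za Zb; rewrite D1 //.
  have [t'a|/(top_belowP t't)//] := eqVneq (t' a) Zero; exfalso.
  have [|eD|eD] := infinity_unique Vt na ta pa LZ LD nZ nD Zg Dg Za.
  - by rewrite D1.
  - by rewrite eD Zf eqxx in nDf.
  have Db : t' b = Neg by rewrite -D1 // eD ffunE Zb.
  by have := top_belowP t't (e := b); rewrite Db => /(_ isT).
have Da1 : D a1 = Pos by apply: (Da a1 a2 Z1).
have Da2 : D a2 = Pos by apply: (Da a2 a1 Z2).
have [W [LW Wg Wf Wa1 Wa2]] : exists W, [/\ W \in covectors M, W g = Zero,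
    W f = Zero, W a1 = Pos & W a2 = Pos].
  have [Df|Df] := eqVneq (D f) Zero; first by exists D.
  have [|W [LW Wf W1 W2 W3]] := elim_opp LD LZ1 Df.
    by rewrite Z1f; move: Df nDf; case: (D f); case: s ns.
  exists W; split=> //; first by rewrite W1 // Z1g.
    by rewrite W2.
  by rewrite W3 // Da2.
(* [X] has the signs of [s] at [f] and of [Z2] at [a1], but it lies on the   *)
(* line of [a2] as [Z2] does.                                                *)
have [||X [LX Xa2 X1 X2 _]] := elim_opp (covectorN LZ1) LW (e := a2).
- by rewrite ffunE Z1a2.
- by rewrite ffunE Z1a2 Wa2.
have Xf : X f = s by rewrite X2 // ffunE Z1f; case: s.
have Xa1 : X a1 = Pos by rewrite X1 // ffunE Z1a1.
have nX : X != zerov by apply/neq0P; exists a1; rewrite Xa1.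
have Xg : X g = Zero by rewrite X1 // ffunE Z1g.
have [eX|eX] := infinity_unique Vt na2 ta2 pa2 LZ2 LX nZ2 nX Z2g Xg Z2a2 Xa2.
  by move: Xf; rewrite eX Z2f; case: s ns.
by move: Xa1; rewrite eX ffunE Z2a1.
Qed.

(** The direction between two sinks would lie on both sides of [f].           *)
Lemma sink_unique t t' : is_sink VP (sarc s) t -> is_sink VP (sarc s) t' -> t = t'.
Proof.
move=> st st'; have /sinkP[Vt _] := st; have /sinkP[Vt' _] := st'.
have [//|ntt'] := eqVneq t t'.
have [D dD] := direction_exists Vt Vt'.
have Df := sink_cone st Vt' ntt' dD.
have nt't : t' != t by rewrite eq_sym.
have := sink_cone st' Vt nt't (direction_opp dD).
by rewrite ffunE Df; case: s ns.
Qed.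

(** The points at infinity on one side of [f] are linearly ordered, from [W]  *)
(** to [- W]. Along a directed walk the directions of the arcs turn           *)
(** monotonically away from [W]: more and more elements separate them from    *)
(** [W]. Hence the walk cannot go on forever.                                 *)
Lemma reach_sink_from W : W \in covectors M -> W != zerov -> W g = Zero ->
    W f = Zero -> forall u v Z a, u \in VP -> v \in VP -> edge M g f u v ->
    direction u v Z -> Z f = s -> a != f -> u a = Zero -> v a = Zero ->
    top a != Zero -> W a = Neg ->
  exists p, [/\ all (mem VP) p, path (sarc s) v p &
    is_sink VP (sarc s) (last v p)].
Proof.
move=> LW nW Wg Wf u v Z.
have [n] := ubnP (#|T| - #|[set e | separates W Z e]|).
elim: n u v Z => // n IH u v Z len a Vu Vv uv dZ Zf naf ua va ta Wa.
have [snk|] := boolP (is_sink VP (sarc s) v); first by exists [::].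
rewrite /is_sink Vv /= => /forall_inPn[w Vw]; rewrite negbK => avw.
have [Z' dZ'] := direction_exists Vv Vw.
have /andP[vw /eqP Z'f] : edge M g f v w && (Z' f == s) by rewrite -(sarcE s Vv Vw dZ').
have nuw : u != w.
  have auv : sarc s u v by rewrite (sarcE s Vu Vv dZ) uv Zf eqxx.
  by apply: contraTneq avw => <-; apply: sarc_asym.
have [a' [na'f va' wa' ta']] := edge_support Vv Vw vw.
have wa : w a = Pos by apply: (edge_turn Vu Vv Vw).
have ua' : u a' = Pos.
  by apply: (edge_turn Vw Vv Vu); rewrite // 1?edgeC // eq_sym.
have [LZ Zg Z1 Z2] := dZ; have [LZ' Z'g Z'1 Z'2] := dZ'.
have Za : Z a = Zero by rewrite Z1.
have Z'a : Z' a = Pos by rewrite Z'1.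
have Za' : Z a' = Neg by rewrite Z2 // ua'.
have Z'a' : Z' a' = Zero by rewrite Z'1.
(* Eliminating [f] between consecutive directions gives back [W]. *)
have [||D [LD Df D1 D2 D3]] := elim_opp LZ (covectorN LZ') (e := f).
- by rewrite Zf.
- by rewrite ffunE Zf Z'f.
have Da : D a = Neg by rewrite D1 // ffunE Z'a.
have eDW : D = W.
  have nD : D != zerov by apply/neq0P; exists a; rewrite Da.
  have [_ Lu _ _ ug] := vertex_facts Vu; have [U LU Uu] := covector_lift Lu.
  have [|||eD|eD] :=
    line_unique (p := f) (q := g) rM LZ LU _ Zg _ LW LD nW nD Wf Wg Df => //.
  - by rewrite Zf.
  - by rewrite Uu ?ug // eq_sym.
  - by rewrite D1 // ffunE Z'g.
  by move: Da; rewrite eD ffunE Wa.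
have Wa' : W a' = Neg by rewrite -eDW D2 // ffunE Z'a'.
have [|p [Vp wp lp]] := IH v w Z' _ a' Vv Vw vw dZ' Z'f na'f va' wa' ta' Wa'.
  have lt_sep : #|[set e | separates W Z e]| < #|[set e | separates W Z' e]|.
    apply: proper_card; apply/properP; split; last first.
      by exists a; rewrite !in_set /separates Wa ?Za ?Z'a.
    apply/subsetP => e; rewrite !in_set /separates => /andP[nWe /eqP We].
    rewrite nWe /=; apply: contraT => sepZ'.
    have nef : e != f by apply: contraNneq nWe => ->; rewrite Wf.
    have De : D e = Z e.
      have [Z'e|nZ'e] := eqVneq (Z' e) Zero; first by rewrite D2 // ffunE Z'e.
      apply: D3; rewrite ffunE; move: nWe We sepZ' nZ'e.
      by case: (W e); case: (Z e); case: (Z' e).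
    by move: We; rewrite -De eDW; case: (W e) nWe.
  rewrite -ltnS; apply: leq_trans len; rewrite ltnS; apply: ltn_sub2l => //.
  exact: leq_trans lt_sep (max_card _).
exists (w :: p); split=> //.
  by apply/andP; split.
by apply/andP; split.
Qed.

Lemma reach_sink : {in VP &, forall u v, sarc s u v ->
  exists p, [/\ all (mem VP) p, path (sarc s) v p &
    is_sink VP (sarc s) (last v p)]}.
Proof.
move=> u v Vu Vv auv.
have [snk|] := boolP (is_sink VP (sarc s) v); first by exists [::].
rewrite /is_sink Vv /= => /forall_inPn[w Vw]; rewrite negbK => avw.
have [Z dZ] := direction_exists Vu Vv; have [Z' dZ'] := direction_exists Vv Vw.
have [uv /eqP Zf] : edge M g f u v /\ Z f == s.
  by apply/andP; rewrite -(sarcE s Vu Vv dZ).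
have [vw /eqP Z'f] : edge M g f v w /\ Z' f == s.
  by apply/andP; rewrite -(sarcE s Vv Vw dZ').
have nuw : u != w by apply: contraTneq avw => <-; apply: sarc_asym.
have [a [naf ua va ta]] := edge_support Vu Vv uv.
have wa : w a = Pos by apply: (edge_turn Vu Vv Vw).
have [LZ Zg Z1 _] := dZ; have [LZ' Z'g Z'1 _] := dZ'.
(* [W] is where the line of [f] meets the line at infinity. *)
have [||W [LW Wf W1 W2]] := elim_pm LZ' LZ (e := f).
- by rewrite Z'f.
- by rewrite Zf.
have Wa : W a = Pos by rewrite W1 ?Z'1 ?Z1.
have Wg : W g = Zero by apply/(W2 g Z'g).
have nW : W != zerov by apply/neq0P; exists a; rewrite Wa.
apply: (reach_sink_from (W := oppv W) (covectorN LW) _ _ _ Vu Vv uv dZ Zf naf ua va ta).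
- by rewrite oppv_eq0.
- by rewrite ffunE Wg.
- by rewrite ffunE Wf.
by rewrite ffunE Wa.
Qed.

Lemma sink_exists : exists t, forall v, is_sink VP (sarc s) v = (v == t).
Proof.
have [u Vu] := vertex_exists.
suff [t snk] : exists t, is_sink VP (sarc s) t.
  exists t => v; apply/idP/eqP => [snk'|->//].
  exact: sink_unique.
have [w [w2 [Vw _ _ adj]]] := two_neighbours3 Vu.
have : sarc s u w || sarc s w u by rewrite sarc_edge // adj // eqxx.
case/orP => auw.
  by have [p [_ _ snk]] := reach_sink Vu Vw auw; exists (last w p).
by have [p [_ _ snk]] := reach_sink Vw Vu auw; exists (last u p).
Qed.

End Orientation.

Lemma holt_klee3 : holt_klee VP (Defs.arc M g f) 2.
Proof.
have [t snk] := @sink_exists Pos isT; have [s src] := @sink_exists Neg isT.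
apply: (@holt_klee_polygon _ VP (Defs.arc M g f) _ _ _ s t) => //.
- by move=> u v; apply: (@sarc_asym Pos).
- move=> u Vu; have [w1 [w2 [Vw1 Vw2 nw adj]]] := two_neighbours3 Vu.
  exists w1, w2; split=> // w Vw; rewrite -adj //.
  exact: (@sarc_edge Pos).
- exact: (@reach_sink Pos).
move=> v; rewrite -src; apply/sourceP/sinkP => -[Vv H]; split=> // w Vw.
  by rewrite (@sarc_opp Pos) //; apply: H.
by have := H w Vw; rewrite (@sarc_opp Pos).
Qed.

End RankThree.

(** * Programs of rank at most two *)

Lemma edge_irr u : edge M g f u u = false.
Proof. by rewrite /edge eqxx !andbF. Qed.

Lemma vertices_rank1 : rank M <= 1 -> forall u v, u \in VP -> v \in VP -> u = v.
Proof.
move=> r1 u v /vertex_facts[_ Lu nu ut _] /vertex_facts[_ Lv nv vt _].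
have rN : rank N <= 1 := leq_trans (rank_deletion _ _) r1.
suff tE w : w \in covectors N -> w != zerov -> confle w top -> w = top.
  by rewrite (tE u Lu nu ut) (tE v Lv nv vt).
move=> Lw nw wt; apply/eqP; apply: contraT => nwt.
by have := rank1_chain rN Lw Ltop nw; rewrite /ltv wt nwt.
Qed.

Lemma holt_klee1 : rank M <= 1 -> holt_klee VP (Defs.arc M g f) 0.
Proof.
move=> r1; have [u Vu] := vertex_exists; exists u, u.
have uniqu v : v \in VP -> v = u by move=> Vv; apply: vertices_rank1.
have noarc : ~~ Defs.arc M g f u u by rewrite /Defs.arc edge_irr.
split.
- move=> v; apply/sourceP/eqP => [[/uniqu]//|->].
  by split=> // w /uniqu->.
- move=> v; apply/sinkP/eqP => [[/uniqu]//|->].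
  by split=> // w /uniqu->.
by exists (fun=> [::]); split; case.
Qed.

(** In rank two the feasible region is a segment. *)
Lemma vertices_rank2 : rank M = 2 -> exists u v,
  [/\ VP = [set u; v], u != v, edge M g f u v, edge M g f v u & aligned u v].
Proof.
move=> r2; have rN : rank N <= 2 by rewrite -r2; apply: rank_deletion.
have rM : rank M <= 2 by rewrite r2.
have [u Vu] := vertex_exists; have [Cu Lu nu ut ug] := vertex_facts Vu.
have no3 X Y Z : X \in covectors N -> Y \in covectors N -> Z \in covectors N ->
    X != zerov -> ltv X Y -> ltv Y Z -> False.
  by move=> LX LY LZ nX XY YZ; have := rank2_chain rN LX LY LZ nX XY; rewrite YZ.
have ltut : ltv u top.
  rewrite /ltv ut; apply/eqP => eu; have := rank_top_cocircuit.
  by rewrite -eu Cu r2 => /(_ isT).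
have [|v [Lv v0 vt nvu two]] := diamond (covector0 N) Lu Ltop (zero_ltv nu) ltut.
  move=> B C LB LC B0 BC; apply/negP => Ct.
  exact: (no3 B C top LB LC Ltop (ltv_neq0 B0) BC Ct).
have nv := ltv_neq0 v0; have levt := ltv_confle vt.
have Cv : v \in cocircuits N.
  apply/cocircuitP; split=> // B LB nB Bv; apply/eqP; apply: contraT => nBv.
  by case: (no3 B v top); rewrite // /ltv Bv.
have Vv : v \in VP by apply/vertices_plusP.
have nuv : u != v by rewrite eq_sym.
have VPE : VP = [set u; v].
  apply/setP => w; apply/idP/set2P => [Vw|[]->//].
  have [Cw Lw nw wt wg] := vertex_facts Vw; apply: two => //; first exact: zero_ltv.
  rewrite /ltv wt; apply: contraTneq Cw => ->; apply/negP => /cocircuitP[_ _ mint].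
  by move: ltut; rewrite (mint u) // ltv_irr.
have eY : compv u v = top.
  apply/eqP; apply: contraT => nY.
  case: (no3 u (compv u v) top); rewrite // ?covectorC ?(vertex_ltv Vu Vv) //.
  by rewrite /ltv nY compv_confle.
have eY' : compv v u = top by rewrite -eY (compv_below levt ut).
have htop : height (covectors N) top == 2.
  rewrite eqn_leq; apply/andP; split; last first.
    apply/height_geP; exists [:: u; top]; split=> //.
      rewrite /chain_in; apply/andP; split; first by rewrite /= ltut.
      by apply/and3P; split=> //; apply/andP; split=> //; exact: ltv_neq0 ltut.
    by apply/and3P; split; rewrite ?confle_refl.
  rewrite leqNgt; apply/negP => /height_geP[[|A [|B [|C [|? ?]]]] []] //.
  case/andP=> /and3P[AB BC _] /and4P[/andP[LA nA] /andP[LB _] /andP[LC _] _] _ _.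
  exact: no3 LA LB LC nA AB BC.
have below : [set V in cocircuits N | confle V top] = [set u; v].
  rewrite -VPE; apply/setP => w.
  by apply/setIdP/idP => [[Cw wt]|/vertices_plusP//]; apply/vertices_plusP.
exists u, v; split=> //.
- by rewrite edgeE // nuv eY htop below /=.
- by rewrite edgeE // nvu eY' htop below setUC /=.
move=> X X' LX LX' nX nX' Xg X'g _ _.
have [U LU Uu] := covector_lift Lu.
apply: (point_unique (p := g) rM LU) => //.
by rewrite Uu ?ug // eq_sym.
Qed.

Lemma aligned_sym u v : aligned u v -> aligned v u.
Proof.
move=> al X X' LX LX' nX nX' Xg X'g X0 X'0; apply: al => // e nef ue ve.
  exact: X0.
exact: X'0.
Qed.

Lemma holt_klee2 : generic M g f -> rank M = 2 -> holt_klee VP (Defs.arc M g f) 1.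
Proof.
move=> gen r2; have [u [v [VPE nuv uv vu al]]] := vertices_rank2 r2.
(* Which end of the segment is the source is a matter of naming. *)
wlog auv : u v VPE nuv uv vu al / Defs.arc M g f u v && ~~ Defs.arc M g f v u.
  move=> H; have Vu : u \in VP by rewrite VPE !inE eqxx.
  have Vv : v \in VP by rewrite VPE !inE eqxx orbT.
  have nvu : v != u by rewrite eq_sym.
  have [Z dZ] := direction_exists Vu Vv.
  have sE s := edge_signE s Vu Vv nuv al dZ.
  have sE' s := edge_signE s Vv Vu nvu (aligned_sym al) (direction_opp dZ).
  have nZ : Z f != Zero.
    by rewrite -sE; have /forall_inP/(_ v Vv)/implyP := forall_inP gen u Vu; apply.
  have [a|na] := boolP (Defs.arc M g f u v && ~~ Defs.arc M g f v u).
    exact: (H u v).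
  apply: (H v u) => //; first by rewrite VPE setUC.
    exact: aligned_sym.
  move: na; rewrite /Defs.arc uv vu !andTb sE sE' ffunE.
  by case: (Z f) nZ.
have [auv1 nvu] := andP auv.
have noarc w : ~~ Defs.arc M g f w w by rewrite /Defs.arc edge_irr.
have Vu : u \in VP by rewrite VPE !inE eqxx.
have Vv : v \in VP by rewrite VPE !inE eqxx orbT.
exists u, v; split.
- move=> w; apply/sourceP/eqP => [[]|->].
    by rewrite {1}VPE => /set2P[->//|->] /(_ u Vu); rewrite auv1.
  by split=> // w'; rewrite {1}VPE => /set2P[]->.
- move=> w; apply/sinkP/eqP => [[]|->].
    by rewrite {1}VPE => /set2P[->|->//] /(_ v Vv); rewrite auv1.
  by split=> // w'; rewrite {1}VPE => /set2P[]->.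
exists (fun=> [:: v]); split.
- by move=> i j _; rewrite !ord1.
- by move=> i; rewrite /dipath /= Vu Vv auv1 eqxx inE nuv.
by move=> i j; rewrite !ord1.
Qed.

End Program.

(** * Proper programs *)

Lemma proper_program_HK (T : finType) (M : orientedMatroid T) (g f : T) :
  rank M <= 3 -> proper_program M g f -> HK_program M g f.
Proof.
move=> r3 /and4P[/and5P[Eg nlg Ef nfg ncf] bd /existsP[X /andP[FX tX]] gen].
have /setIdP[LX /andP[/eqP Xg pX]] := FX.
have maxX Y : Y \in covectors M -> confle X Y -> Y = X.
  by move: tX; rewrite inE => /andP[_ /forall_inP H] LY XY; apply/eqP/(implyP (H Y LY)).
have Xtop Y e : Y \in covectors M -> X e = Zero -> Y e = Zero.
  move=> LY Xe; have := compvE X Y e.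
  by rewrite (maxX _ (covectorC LX LY) (confle_compv _ _)) Xe eqxx.
have ncol Y : Y \in covectors M -> (forall e, e != f -> Y e = Zero) -> Y = zerov.
  move=> LY Y0; apply/eqP; apply: contraT => nY; case/negP: ncf.
  have Yf : Y f != Zero.
    by have /neq0P[e] := nY; have [->//|/Y0->] := eqVneq e f.
  apply/exists_inP; exists Y.
    apply/cocircuitP; split=> // Z LZ nZ ZY; apply: confle_anti => //.
    apply/confleP => e; have [->|/Y0->] := eqVneq e f; last by rewrite eqxx.
    move=> _; have /neq0P[d Zd] := nZ.
    have edf : d = f.
      by apply/eqP; apply: contraNT Zd => /Y0/(confle_zero ZY)->.
    by rewrite -edf in Zd *; rewrite (confleP _ _ ZY).
  apply/eqP/setP => e; rewrite !inE.
  by have [->//|/Y0->] := eqVneq e f.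
set top := restrictv (ground M :\: [set f]) X.
have Ltop : top \in covectors (Mf M f) by apply: imset_f.
have topE e : e != f -> top e = X e by apply: resE.
have topf : top f = Zero by rewrite /top ffunE !inE eqxx.
have top_pos e : top e != Zero -> top e = Pos.
  have [->|nef] := eqVneq e f; first by rewrite topf.
  rewrite topE //; have [->//|neg] := eqVneq e g.
  have [Ee nX|/(covector_off LX)->//] := boolP (e \in ground M).
  have : e \in ground M :\: [set g; f] by rewrite !inE negb_or neg nef.
  by move/(forall_inP pX); rewrite !inE (negbTE nX) orbF => /eqP.
have top_max U e : U \in covectors (Mf M f) -> top e = Zero -> U e = Zero.
  move=> LU; have [->|nef] := eqVneq e f; first by rewrite (covector_f LU).
  rewrite topE // => Xe; have [Y LY YU] := covector_lift LU.
  by rewrite -YU // Xtop.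
have top_g : top g = Pos by rewrite topE // eq_sym.
have bnd Y : Y \in covectors M -> Y g = Zero ->
    (forall e, e != f -> Y e = Zero \/ Y e = Pos) -> Y = zerov.
  move=> LY Yg pY; apply/eqP; apply: contraT => nY; case/negP: bd.
  apply/andP; split; first by apply/set0Pn; exists X.
  apply/exists_inP; exists Y; rewrite // nY Yg eqxx.
  apply/forall_inP => e; rewrite !inE negb_or => /andP[/andP[_ nef] _].
  by case: (pY e nef) => ->.
have r1 : 0 < rank M.
  apply/rank_geP; exists [:: X] => //.
  by rewrite /chain_in /= LX andbT; apply/neq0P; exists g; rewrite Xg.
rewrite /HK_program; case: (ltngtP (rank M) 2) => [r2|r3'|r2].
- have -> : (rank M).-1 = 0 by case: (rank M) r1 r2 => [|[|]].
  exact: (holt_klee1 nfg Ltop top_pos top_max top_g bnd).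
- have e3 : rank M = 3 by apply/eqP; rewrite eqn_leq r3.
  rewrite e3; exact: (holt_klee3 nfg ncol Ltop top_pos top_max top_g bnd).
rewrite r2; exact: (holt_klee2 nfg ncol Ltop top_pos top_max top_g bnd).
Qed.

Theorem proposition2 (T : finType) (M : orientedMatroid T) (hr : rank M <= 3) :
  HK M.
Proof.
move=> N MN f g Nf Ng fg; apply: proper_program_HK.
exact: leq_trans (rank_minor MN) hr.
Qed.
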